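(* Let $A\in\mathbb{R}^{n\times n}$, $B\in\mathbb{R}^{n\times m}$, $K\in\mathbb{R}^{m\times n}$. Let $T>0$, $r,\tau\ge0$ with $r+\tau>0$, and suppose that there exists $l\in Z^+$ such that $\tau=lT$. Define $q:=\left[\frac rT\right]$ and $\tilde r=r-qT$. Suppose that all the eigenvalues of the matrix $\exp(AT)\left(I+\int_0^T\exp(-Aw)\,dw\,BK\right)$ are strictly inside the unit circle of the complex plane. Then the closed-loop system $$\dot x(t)=Ax(t)+Bu(t-\tau),\qquad u(t)=u_i,\ t\in[iT,(i+1)T),\ i\in Z^+,$$ with input applied with zero order hold given by $$u_i=K\exp(A(r+\tau))\,y_i+K\sum_{p=1}^{l+q+1}Q_pBu_{i-p},\quad i\in Z^+,$$ where $y_i=x(iT-r)$ and $$Q_p=\exp(ApT)\int_0^T\exp(-As)\,ds,\ p=1,\dots,l+q,\qquad Q_{l+q+1}=\exp(A(l+q)T)\int_0^{\tilde r}\exp(As)\,ds,$$ is globally exponentially stable, in the sense that there exist constants $M,\sigma>0$ such that for every $(x_0,u_0)\in C^0([-r,0];\mathbb{R}^n)\times L^\infty([-r-\tau,0);\mathbb{R}^m)$ the solution $(x(t),u(t))\in\mathbb{R}^n\times\mathbb{R}^m$ of the closed-loop system with initial condition $\breve T_{r+\tau}(0)u=u_0$, $T_r(0)x=x_0$ satisfies, for all $t\ge0$, $$\|T_r(t)x\|_r+\|\breve T_{r+\tau}(t)u\|_{r+\tau}\le M\big(\|x_0\|_r+\|u_0\|_{r+\tau}\big)\exp(-\sigma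 t).$$
   Context: Notation. $Z^+$ is the set of non-negative integers, $|\cdot|$ is the Euclidean norm, $[s]$ is the integer part of $s\ge0$, $I$ is the identity matrix. $L^\infty(I;U)$ is the space of measurable and bounded functions on the interval $I$ with values in $U$; functions differing on a null set are not identified. History: $(T_r(t)x)(\theta)=x(t+\theta)$ for $\theta\in[-r,0]$, and $(\breve T_r(t)x)(\theta)=x(t+\theta)$ for $\theta\in[-r,0)$. Norms: $\|x\|_r=\sup_{\theta\in[-r,0]}|x(\theta)|$ for functions on $[-r,0]$ and $\|x\|_r=\sup_{\theta\in[-r,0)}|x(\theta)|$ for functions on $[-r,0)$ (actual supremum). Convention: $C^0([-r,0];\mathbb{R}^n)=\mathbb{R}^n$ when $r=0$. Negative indices: when $i-p<0$ (so that the term refers to the initial input history), the term $Q_pBu_{i-p}$ stands for $\int_{-\min(pT,\,r+\tau)}^{-(p-1)T}\exp(-As)\,B\,u(iT+s)\,ds$, which equals $Q_pBu_{i-p}$ whenever $u$ takes the constant value $u_{i-p}$ on the corresponding interval. Thus the control law is $u_i=K\big(\exp(A(r+\tau))y_i+\int_{-r-\tau}^0\exp(-As)Bu(iT+s)\,ds\big)$. *)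

(* Defs.v *)
From HB Require Import structures.
From mathcomp Require Import all_boot all_order all_algebra.
From mathcomp Require Import all_classical all_reals all_analysis.
From mathcomp Require Export complex.
Set Implicit Arguments.
Unset Strict Implicit.
Unset Printing Implicit Defensive.
Import Order.TTheory GRing.Theory Num.Theory.
Import numFieldNormedType.Exports.
Local Open Scope classical_set_scope.
Local Open Scope ring_scope.

Definition enorm (R : realType) (n : nat) (v : 'cV[R]_n) : R :=
  Num.sqrt (\sum_(i < n) v i 0 ^+ 2).

Definition expm (R : realType) (n : nat) (A : 'M[R]_n) : 'M[R]_n :=
  limn (series (fun k => k`!%:R^-1 *: A ^+ k)).

(* The real line with the sigma-algebra of Lebesgue measurable sets; the
   default one on R : realType is the Borel sigma-algebra. *)
Notation lebesgueR R := (caratheodory_type (@wlength R idfun)^*%mu).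

(* Only meaningful for a <= b: the integral over an empty interval is 0. *)
Definition mint (R : realType) (m n : nat) (a b : R) (F : R -> 'M[R]_(m, n))
    : 'M[R]_(m, n) :=
  \matrix_(i, j) (\int[completed_lebesgue_measure]_(s in `[a, b]) F s i j)%R.

Definition history (R : realType) (n : nat) (t : R) (f : R -> 'cV[R]_n)
    : R -> 'cV[R]_n :=
  fun theta => f (t + theta).

(* Suprema in R; they are genuine for functions bounded on the interval. *)
Definition supnorm_closed (R : realType) (n : nat) (r : R)
    (f : R -> 'cV[R]_n) : R :=
  sup [set enorm (f theta) | theta in `[- r, 0]].

Definition supnorm_open (R : realType) (n : nat) (r : R)
    (f : R -> 'cV[R]_n) : R :=
  sup [set enorm (f theta) | theta in `[- r, 0[].

Definition measurable_bounded (R : realType) (m : nat) (D : set R)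
    (u : R -> 'cV[R]_m) : Prop :=
  (forall i, measurable_fun (D : set (lebesgueR R)) (fun s => u s i 0)) /\
  (exists C : R, forall s, D s -> enorm (u s) <= C).

(* The list s consists of intervals [p.1, p.2] of [a, b] with disjoint
   interiors. *)
Definition abs_continuous_on (R : realType) (n : nat) (a b : R)
    (f : R -> 'cV[R]_n) : Prop :=
  forall e : R, 0 < e -> exists2 d : R, 0 < d &
  forall s : seq (R * R),
    all (fun p => (a <= p.1) && (p.1 <= p.2) && (p.2 <= b)) s ->
    pairwise (fun p p' => (p.2 <= p'.1) || (p'.2 <= p.1)) s ->
    \sum_(p <- s) (p.2 - p.1) < d ->
    \sum_(p <- s) enorm (f p.2 - f p.1) < e.

(* Solution in the sense of Caratheodory, since u is merely measurable on
   [-r - tau, 0). *)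
Definition delay_ode (R : realType) (n m : nat) (A : 'M[R]_n)
    (B : 'M[R]_(n, m)) (tau : R) (x : R -> 'cV[R]_n) (u : R -> 'cV[R]_m)
    : Prop :=
  (forall b : R, 0 <= b -> abs_continuous_on 0 b x) /\
  {ae lebesgue_measure, forall t : R, 0 <= t ->
     is_derive t 1 x (A *m x t + B *m u (t - tau))}.

(* Used for 1 <= p <= l + q + 1 only. *)
Definition Qmx (R : realType) (n : nat) (A : 'M[R]_n) (T rt : R) (l q p : nat)
    : 'M[R]_n :=
  if (p <= l + q)%N then
    expm ((p%:R * T) *: A) *m mint 0 T (fun s => expm (- s *: A))
  else
    expm (((l + q)%:R * T) *: A) *m mint 0 rt (fun s => expm (s *: A)).

(* The term Q_p B u_(i - p); for i < p it refers to the input before time 0,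
   which need not be piecewise constant, hence the integral. *)
Definition input_term (R : realType) (n m : nat) (A : 'M[R]_n)
    (B : 'M[R]_(n, m)) (T r tau rt : R) (l q : nat)
    (u : R -> 'cV[R]_m) (v : nat -> 'cV[R]_m) (i p : nat) : 'cV[R]_n :=
  if (p <= i)%N then Qmx A T rt l q p *m B *m v (i - p)%N
  else mint (- Num.min (p%:R * T) (r + tau)) (- (p.-1%:R * T))
         (fun s => expm (- s *: A) *m B *m u (i%:R * T + s)).

Definition control_law (R : realType) (n m : nat) (A : 'M[R]_n)
    (B : 'M[R]_(n, m)) (K : 'M[R]_(m, n)) (T r tau rt : R) (l q : nat)
    (x : R -> 'cV[R]_n) (u : R -> 'cV[R]_m) (v : nat -> 'cV[R]_m) (i : nat)
    : 'cV[R]_m :=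
  K *m expm ((r + tau) *: A) *m x (i%:R * T - r)
  + K *m \sum_(1 <= p < (l + q + 1).+1)
           input_term A B T r tau rt l q u v i p.

(* x and u are total functions on R; only their values on [-r, +oo) and
   [-r - tau, +oo) are constrained. *)
Definition closed_loop_solution (R : realType) (n m : nat) (A : 'M[R]_n)
    (B : 'M[R]_(n, m)) (K : 'M[R]_(m, n)) (T r tau rt : R) (l q : nat)
    (x0 : R -> 'cV[R]_n) (u0 : R -> 'cV[R]_m)
    (x : R -> 'cV[R]_n) (u : R -> 'cV[R]_m) : Prop :=
  [/\ {in `[- r, 0], history 0 x =1 x0},
      {in `[- (r + tau), 0[, history 0 u =1 u0},
      delay_ode A B tau x u &
      exists v : nat -> 'cV[R]_m,
        (forall i : nat,
           {in `[i%:R * T, i.+1%:R * T[, forall t, u t = v i}) /\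
        (forall i : nat, v i = control_law A B K T r tau rt l q x u v i)].

(* Main.v *)
From HB Require Import structures.
Require Import Defs.
From mathcomp Require Import all_boot all_order all_algebra.
From mathcomp Require Import all_classical all_reals all_analysis.
From mathcomp Require Import measurable_realfun ring lra mxpoly.
Set Implicit Arguments.
Unset Strict Implicit.
Unset Printing Implicit Defensive.
Import Order.TTheory GRing.Theory Num.Theory.
Import numFieldNormedType.Exports.
Local Open Scope classical_set_scope.
Local Open Scope ring_scope.

(** The feedback is a predictor.  Variation of constants over the window
    [iT - r, iT + tau] turns the measurement x(iT - r) and the stored input into
    x(iT + tau).  For i > q this window lies in t >= 0, where the equation holds,
    and the Q_p are the integrals of exp(-As) over the successive pieces of the
    window ([Qmx_mint]), so the control law reads v_i = K x(iT + tau)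
    ([control_predicts]).  The constant v_i is the input that acts on the state
    during [iT + tau, (i+1)T + tau), hence the samples x(iT + tau) obey the linear
    recursion with the Schur matrix ([predictor_step]) and decay geometrically
    ([schur_powers], [sampled_state_decay]).

    For i <= q the measurement belongs to the initial history, which need not
    satisfy the equation, and the predictor is inexact.  There are finitely many
    such steps, and the control law is bounded by the data
    ([control_bound], [input_bound_init]); a state_growth estimate for the equation
    ([state_growth]) bounds the state on this initial stretch and between two
    samples.  Each of these constants depends on the matrices and the delays only,
    which makes the final estimate uniform in the initial data.

    The analytic core is variation of constants for an absolutely continuous
    solution driven by a bounded measurable input ([duhamel]), where the integral
    is taken for the completed Lebesgue measure.  It splits in two.  A gauge
    argument shows that an absolutely continuous function whose derivative is
    almost everywhere at most C in absolute value is C-Lipschitz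
    ([abs_continuous_le]).  For a Lipschitz function, the difference quotients are
    uniformly bounded and converge almost everywhere to the derivative, so
    dominated convergence yields the fundamental theorem of calculus
    ([Rintegral_lipschitz]); the derivative is measurable because the measure is
    complete.  This last theorem also serves to move constant matrices in and out
    of integrals of the exponential and to change variables in them: both sides
    are increments of primitives. *)

(** * Bounds for the completed Lebesgue integral *)

Section completed.
Context {R : realType}.
Notation mu := (@lebesgue_measure R).
Notation cmu := (@completed_lebesgue_measure R).

Lemma measurable_fun_id_completed :
  measurable_fun [set: lebesgueR R] (id : lebesgueR R -> measurableTypeR R).
Proof. by move=> _ B mB; rewrite setTI; exact: sub_caratheodory. Qed.

Lemma ae_completed (P : R -> Prop) :
  {ae mu, forall x, P x} -> {ae cmu, forall x, P x}.
Proof.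
by move=> [N [mN N0 subN]]; exists N; split => //; exact: sub_caratheodory.
Qed.

Lemma measurable_completed_itv (a b : R) :
  measurable (`[a, b]%classic : set (lebesgueR R)).
Proof. by apply: sub_caratheodory; exact: measurable_itv. Qed.

Lemma completed_itv (a b : R) : a <= b ->
  cmu (`[a, b]%classic : set (lebesgueR R)) = (b - a)%:E.
Proof.
move=> ab; change (mu `[a, b]%classic = (b - a)%:E).
rewrite lebesgue_measure_itv /= lte_fin.
by case: ltgtP ab => // -> _; rewrite subrr.
Qed.

Lemma measurable_fun_completed (D : set R) (h : R -> R) :
  measurable_fun [set: measurableTypeR R] h ->
  measurable_fun (D : set (lebesgueR R)) h.
Proof.
move=> mh; apply: (@measurable_funS _ _ _ _ [set: lebesgueR R]) => //.
exact: (measurableT_comp mh measurable_fun_id_completed).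
Qed.

(** The integral of a nonnegative function is a supremum over the simple functions
    below it, so monotonicity holds for arbitrary functions. *)
Lemma ge0_integral_le_bound d (X : measurableType d)
    (nu : {measure set X -> \bar R}) (D : set X) (f g : X -> \bar R) :
  (forall x, D x -> (0 <= f x)%E) ->
  (forall x, D x -> (f x <= g x)%E) ->
  (\int[nu]_(x in D) f x <= \int[nu]_(x in D) g x)%E.
Proof.
move=> f0 fg; rewrite !ge0_integralE// => [|x Dx]; last first.
  exact: le_trans (f0 x Dx) (fg x Dx).
apply: le_ereal_sup => _ /= [h hf <-]; exists h => // x.
apply: le_trans (hf x) _; rewrite !patchE; case: ifPn => //.
by rewrite inE => /fg.
Qed.

Lemma ae_neq (y : R) : {ae mu, forall x, x <> y}.
Proof.
exists [set y]; split; [exact: measurable_set1|exact: lebesgue_measure_set1|].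
by move=> x /= /contrapT.
Qed.

(** Integrands of the control law at time iT involve u(iT) at an endpoint, a value
    that is still to be estimated; hence the bound on the open interval only. *)
Lemma normr_Rintegral_le (a b C : R) (f : R -> R) : a <= b -> 0 <= C ->
  (forall x, a < x < b -> `|f x| <= C) ->
  `|\int[cmu]_(x in `[a, b]) f x| <= C * (b - a).
Proof.
move=> ab C0 fC; rewrite /Rintegral integralE.
set D : set (lebesgueR R) := `[a, b]%classic.
have mD : measurable D by exact: measurable_completed_itv.
(* B dominates f on the closed interval and equals C almost everywhere *)
pose B (x : lebesgueR R) : R := if a < x < b then C else Num.max `|f a| `|f b|.
have fB x : D x -> `|f x| <= B x.
  rewrite /D /B /= in_itv /= => /andP[ax xb]; case: ifPn => [/fC//|].
  rewrite negb_and -!leNgt le_max => /orP[xa|bx].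
    by rewrite (@le_anti _ _ x a) ?lexx// xa ax.
  by rewrite (@le_anti _ _ x b) ?lexx ?orbT// bx xb.
have B0 x : D x -> 0 <= B x by move=> /fB; exact: le_trans (normr_ge0 _).
have BC : ae_eq cmu D (cst C%:E) (EFin \o B).
  apply: ae_completed;
  apply: (filterS2 (ae_filter_ringOfSetsType mu)) (ae_neq a) (ae_neq b).
  move=> x xa xb; rewrite /D /= in_itv/= => /andP[ax bx].
  rewrite /B !lt_neqAle ax bx !andbT.
  by rewrite [a == x]eq_sym; move/eqP : xa => ->; move/eqP : xb => ->.
have mB : measurable_fun D (EFin \o B).
  exact: (ae_measurable_fun completed_lebesgue_measure_is_complete BC (measurable_cst _)).
have cE : (\int[cmu]_(x in D) (EFin \o B) x = (C * (b - a))%:E)%E.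
  rewrite -(ae_eq_integral _ _ _ (measurable_cst _) mB BC)//.
  by rewrite integral_cst// EFinM; congr (_ * _)%E; exact: completed_itv.
set g := (fun x : lebesgueR R => (f x)%:E).
have gp : (\int[cmu]_(x in D) g ^\+ x <= (C * (b - a))%:E)%E.
  rewrite -cE; apply: ge0_integral_le_bound => // x Dx.
  rewrite funeposE /g -EFin_max lee_fin ge_max B0// andbT.
  by rewrite (le_trans (ler_norm _))// fB.
have gn : (\int[cmu]_(x in D) g ^\- x <= (C * (b - a))%:E)%E.
  rewrite -cE; apply: ge0_integral_le_bound => // x Dx.
  rewrite funenegE /g -EFinN -EFin_max lee_fin ge_max B0// andbT.
  by rewrite (le_trans (ler_norm _))// normrN fB.
have gp0 : (0 <= \int[cmu]_(x in D) g ^\+ x)%E by exact: integral_ge0.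
have gn0 : (0 <= \int[cmu]_(x in D) g ^\- x)%E by exact: integral_ge0.
move: gp gn gp0 gn0.
case: (integral _ _ _) => [p| |]//; case: (integral _ _ _) => [n| |]//=.
rewrite !lee_fin => ? ? ? ?; rewrite ler_norml; lra.
Qed.

End completed.

(** * Translation of null sets *)

Section translation.
Context {R : realType}.
Notation mu := (@lebesgue_measure R).

Lemma measurable_shift (c : R) : measurable_fun [set: measurableTypeR R]
  ((fun x => x + c) : measurableTypeR R -> measurableTypeR R).
Proof. by apply: measurable_funD; [exact: measurable_id|exact: measurable_cst]. Qed.

Lemma lebesgue_measure_shift (c : R) (N : set (measurableTypeR R)) : measurable N ->
  mu ((fun x => x + c) @^-1` N) = mu N.
Proof.
move=> mN.
have mf : measurable_fun [set: measurableTypeR R]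
    ((fun x => x + c) : measurableTypeR R -> measurableTypeR R).
  exact: measurable_shift.
pose f : {mfun measurableTypeR R >-> measurableTypeR R} :=
  HB.pack ((fun x => x + c) : measurableTypeR R -> measurableTypeR R)
    (isMeasurableFun.Build _ _ _ _ _ mf).
have := @lebesgue_measure_unique R (pushforward mu f) _ N mN.
move=> ->// X [[a b] _ <-]; rewrite /pushforward.
rewrite [X in _ = mu X](_ : _ = `]a - c, b - c]%classic); last first.
  by apply/seteqP; split => x /=; rewrite !in_itv/= ltrBlDr lerBrDr.
rewrite !lebesgue_measure_itv/= !lte_fin ltrD2r.
by case: ifP => // _; rewrite -!EFinB; congr EFin; lra.
Qed.

(** The equation holds almost everywhere in absolute time, whereas the control law
    integrates over the time elapsed since iT. *)
Lemma ae_shift (c : R) (P : R -> Prop) :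
  {ae mu, forall x, P x} -> {ae mu, forall x, P (x + c)}.
Proof.
move=> [N [mN N0 subN]]; exists ((fun x => x + c) @^-1` N); split.
- have mf : measurable_fun [set: measurableTypeR R]
    ((fun x => x + c) : measurableTypeR R -> measurableTypeR R).
    exact: measurable_shift.
  by rewrite -[X in measurable X]setTI; exact: mf.
- by rewrite lebesgue_measure_shift.
- by move=> x /= nP; exact: subN.
Qed.
End translation.

(** * Integration of the derivative of a Lipschitz function *)

Section ftc.
Context {R : realType}.
Notation mu := (@lebesgue_measure R).
Notation cmu := (@completed_lebesgue_measure R).

Lemma integrable_completed (a b C : R) (f : R -> R) : a <= b ->
  measurable_fun (`[a, b]%classic : set (lebesgueR R)) f ->
  (forall x, a <= x <= b -> `|f x| <= C) ->
  cmu.-integrable (`[a, b]%classic : set (lebesgueR R)) (EFin \o f).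
Proof.
move=> ab mf fC; apply: measurable_bounded_integrable => //.
- exact: measurable_completed_itv.
- apply: (@le_lt_trans _ _ (b - a)%:E); last by rewrite ltry.
  rewrite le_eqVlt; apply/orP; left; apply/eqP; exact: completed_itv.
- exists C; split; first by rewrite num_real.
  move=> x Cx y; rewrite /= in_itv /= => /fC /le_trans; apply; exact: ltW.
Qed.

(** The Lebesgue measure on Borel sets is the image of the completed measure under
    the identity, so theorems on the former apply to continuous integrands. *)
Lemma integral_completed (a b C : R) (f : R -> R) : a <= b ->
  continuous f -> (forall x, a <= x <= b -> `|f x| <= C) ->
  (\int[cmu]_(x in `[a, b]) (f x)%:E = \int[mu]_(x in `[a, b]) (f x)%:E)%E.
Proof.
move=> ab cf fC.
have mf := continuous_measurable_fun cf.
have := @integral_pushforward _ _ _ _ _ _ (@measurable_fun_id_completed R) cmu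
  `[a, b]%classic (EFin \o f).
move=> H; rewrite -H //; first exact/measurable_EFinP.
  apply: integrable_completed fC => //; exact: measurable_fun_completed.
Qed.

Lemma locally_primitive (a b : R) (h : R -> R) : continuous h ->
  exists H : R -> R, forall x, a < x < b -> is_derive x 1 H (h x).
Proof.
move=> ch; exists (fun x => \int[mu]_(t in `[a, x]) h t) => x /andP[ax xb].
have [] := @continuous_FTC1_closed R h a x b xb _ ax (ch x).
  apply: continuous_compact_integrable; first exact: segment_compact.
  exact: continuous_subspaceT.
by move=> d e; split; [exact: d | rewrite -derive1E].
Qed.

Lemma is_derive_diffquo (f : R -> R) (x d : R) : is_derive x 1 f d ->
  (f (x + n.+1%:R^-1) - f x) / n.+1%:R^-1 @[n --> \oo] --> d.
Proof.
move=> [df <-]; rewrite /derive.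
have := df; rewrite /derivable => /cvg_ex[/= l hl].
rewrite (cvg_lim _ hl)//.
have : (fun n => n.+1%:R^-1 : R) @ \oo --> 0^'.
  move=> A [e /= e0 eA].
  have : \forall n \near \oo, (n.+1%:R^-1 : R) < e.
    by apply: near_infty_natSinv_lt (PosNum e0).
  apply: filterS => n ne; apply: eA; rewrite /ball_/= ?sub0r ?normrN.
    by rewrite ger0_norm // invr_ge0.
  by rewrite invr_neq0.
move=> /cvg_comp /(_ hl); apply: cvg_trans; apply: near_eq_cvg.
near=> n; rewrite /= /GRing.scale/= mulr1 mulrC (addrC x).
Unshelve. all: by end_near. Qed.

(** The difference quotients of f are bounded by L and converge almost everywhere
    to g.  Their integrals are increments of difference quotients of a primitive
    of f, which converge to f b - f a; dominated convergence concludes.  The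
    measurability of g comes from completeness of the measure: g agrees almost
    everywhere with a pointwise limit superior of continuous functions. *)
Theorem Rintegral_lipschitz (a b L : R) (f g : R -> R) : a <= b ->
  (forall s t, a <= s <= b -> a <= t <= b -> `|f s - f t| <= L * `|s - t|) ->
  {ae mu, forall s, a < s < b -> is_derive s 1 f (g s)} ->
  \int[cmu]_(s in `[a, b]) g s = f b - f a.
Proof.
rewrite le_eqVlt => /predU1P[->|ab] fL fg.
  apply/eqP; rewrite subrr -normr_le0.
  have := @normr_Rintegral_le R b b 0 g (lexx _) (lexx _).
  rewrite subrr mulr0; apply => x /andP[bx xb].
  by have := lt_trans bx xb; rewrite ltxx.
have L0 : 0 <= L.
  have aab : a <= a <= b by rewrite lexx ltW.
  have bab : a <= b <= b by rewrite lexx ltW.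
  have h := fL b a bab aab.
  have := le_trans (normr_ge0 _) h.
  have ba : 0 < `|b - a| by rewrite normr_gt0 subr_eq0 gt_eqF.
  by rewrite (pmulr_lge0 _ ba).
(* f is extended by constants, since the quotients look to the right of b *)
pose c (t : R) := Num.max a (Num.min b t).
have cab t : a <= c t <= b.
  rewrite /c le_max lexx/= ge_max (ltW ab)/=.
  by rewrite ge_min lexx.
have cid t : a <= t <= b -> c t = t.
  by move=> /andP[a_t tb]; rewrite /c (min_idPr tb) (max_idPr a_t).
have cL s t : `|c s - c t| <= `|s - t|.
  wlog st : s t / s <= t.
    move=> wl; have [/wl//|/ltW/wl] := leP s t.
    by rewrite distrC (distrC t).
  rewrite ler_norml [`|s - t|]distrC (ger0_norm (x := t - s)) ?subr_ge0 //.
  rewrite /c !maxEle !minEle.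
  by repeat case: ifPn; rewrite -?ltNge => *; lra.
pose F t := f (c t).
have FL s t : `|F s - F t| <= L * `|s - t|.
  by rewrite (le_trans (fL _ _ (cab _) (cab _)))// ler_wpM2l.
have cF : continuous F.
  move=> x; apply/cvgrPdist_le => e e0.
  have L1 : 0 < L + 1 by rewrite ltr_wpDl.
  have d0 : 0 < e / (L + 1) by rewrite divr_gt0.
  near=> t; rewrite (le_trans (FL _ _))//.
  apply: (@le_trans _ _ ((L + 1) * `|x - t|)).
    by rewrite ler_wpM2r// lerDl.
  by rewrite mulrC -ler_pdivlMr//.
have [H dH] := locally_primitive (a - 1) (b + 2) cF.
have Fa : F a = f a by rewrite /F cid// lexx ltW.
have Fb : F b = f b by rewrite /F cid// lexx ltW.
pose h (n : nat) : R := n.+1%:R^-1.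
have h0 n : 0 < h n by rewrite invr_gt0.
have h1 n : h n <= 1 by rewrite invf_le1 // ler1n.
pose D n s := (F (s + h n) - F s) / h n.
have DL n s : `|D n s| <= L.
  rewrite normrM normfV (gtr0_norm (h0 n)) ler_pdivrMr//.
  by rewrite (le_trans (FL _ _))// addrC addKr gtr0_norm.
have cD n : continuous (D n).
  move=> s; apply: cvgM; last exact: cvg_cst.
  apply: cvgB; last exact: cF.
  apply: (@continuous_comp _ _ _ (fun s => s + h n) F); last exact: cF.
  by apply: cvgD; [exact: cvg_id|exact: cvg_cst].
pose G n s := (H (s + h n) - H s) / h n.
have dG n s : a <= s <= b -> is_derive s 1 (G n) (D n s).
  move=> /andP[as_ sb].
  have d1 : is_derive s 1 (fun s => H (s + h n)) (F (s + h n)).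
    have : is_derive (s + h n) 1 H (F (s + h n)).
      by apply: dH; have := h0 n; have := h1 n; lra.
    move=> d; have := @is_derive1_comp _ H (shift (h n)) s _ _ d (is_derive_shift s 1 (h n)).
    by rewrite mulr1.
  have d2 : is_derive s 1 H (F s) by apply: dH; lra.
  have -> : G n = (h n)^-1 \*: ((fun s => H (s + h n)) - H).
    by apply/funext => z; rewrite /G mulrC.
  by rewrite /D mulrC; exact: is_deriveZ (is_deriveB d1 d2).
have contG n s : a <= s <= b -> {for s, continuous (G n)}.
  by move=> /(dG n) [d _]; apply: differentiable_continuous; exact/derivable1_diffP.
have ID n : (\int[cmu]_(x in `[a, b]) (D n x)%:E = (G n b - G n a)%:E)%E.
  rewrite (integral_completed (ltW ab) (cD n) (fun x _ => DL n x)).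
  rewrite (@continuous_FTC2 _ _ (G n)) ?EFinB//.
  - by apply: continuous_subspaceT; exact: cD.
  - split.
    + by move=> x; rewrite in_itv/= => /andP[? ?]; have [|//] := dG n x; rewrite !ltW.
    + by apply: cvg_at_right_filter; apply: contG; rewrite lexx ltW.
    + by apply: cvg_at_left_filter; apply: contG; rewrite lexx ltW.
  - move=> x; rewrite in_itv/= => /andP[? ?].
    have xab : a <= x <= b by rewrite !ltW.
    by have [_ E] := dG n x xab; rewrite derive1E E.
pose dom : set (lebesgueR R) := `[a, b]%classic.
have mdom : measurable dom by exact: measurable_completed_itv.
have mD n : measurable_fun dom (EFin \o D n).
  apply/measurable_EFinP; apply: measurable_fun_completed.
  by apply: continuous_measurable_fun; exact: cD.
have aeD : {ae cmu, forall x, dom x -> (EFin \o D n) x @[n --> \oo] --> (g x)%:E}.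
  apply: ae_completed.
  apply: (filterS3 (ae_filter_ringOfSetsType mu)) fg (ae_neq a) (ae_neq b).
  move=> x fgx xa xb; rewrite /dom /= in_itv/= => /andP[ax bx].
  have {}ax : a < x by rewrite lt_neqAle ax andbT; apply/eqP => /esym.
  have {}bx : x < b by rewrite lt_neqAle bx andbT; apply/eqP.
  apply: cvg_EFin; first by near=> n.
  have := is_derive_diffquo (fgx _); rewrite ax bx => /(_ isT).
  apply: cvg_trans; apply: near_eq_cvg; near=> n.
  rewrite /= /D /F -/(h n) !cid ?ltW//; last first.
    by rewrite ltr_wpDr ?(ltW (h0 _)).
  rewrite -ltrBrDl; near: n.
  have bx0 : 0 < b - x by rewrite subr_gt0.
  have := near_infty_natSinv_lt (PosNum bx0); exact.
have mg : measurable_fun dom (EFin \o g).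
  apply: (@ae_measurable_fun _ _ _ cmu completed_lebesgue_measure_is_complete dom
     (fun x => limn_esup (fun n => (EFin \o D n) x))).
    apply: filterS aeD => x /[apply] Dx.
    by have [_ ->] := cvg_limn_einf_sup Dx.
  exact: measurable_fun_limn_esup.
have iL : cmu.-integrable dom (cst L%:E).
  apply: (@integrable_completed a b L (cst L)); first exact: ltW.
    exact: measurable_cst.
  by move=> x _; rewrite ger0_norm.
have aeL : {ae cmu, forall x n, dom x -> (`|(EFin \o D n) x| <= cst L%:E x)%E}.
  by apply: filterE => x n _ /=; rewrite lee_fin.
have [ig _] := dominated_convergence mdom mD mg aeD iL aeL.
have -> : [sequence (\int[cmu]_(x in dom) (EFin \o D n) x)%E]_n =
    (fun n => (G n b - G n a)%:E).
  by apply/funext => n; exact: ID.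
move=> cvg1.
have cvg2 : (fun n => (G n b - G n a)%:E) @ \oo --> (F b - F a)%:E.
  apply: cvg_EFin; first by near=> n.
  apply: cvgB; apply: is_derive_diffquo; apply: dH; lra.
have := cvg_unique _ cvg1 cvg2.
by rewrite /Rintegral Fa Fb => ->.
Unshelve. all: by end_near. Qed.
End ftc.

(** * Absolutely continuous functions with bounded derivative *)

Section ac.
Context {R : realType}.
Notation mu := (@lebesgue_measure R).

(** Compactness of [a, b] in the form of Cousin's lemma: the supremum of the points
    reached from a satisfies P and, unless it is b, is not an upper bound. *)
Lemma real_induction (a b : R) (P : R -> Prop) : a <= b -> P a ->
  (forall t, a <= t <= b -> exists2 d, 0 < d &
    forall x y, a <= x <= t -> t <= y <= b -> t - x < d -> y - t < d ->
      P x -> P y) ->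
  P b.
Proof.
move=> ab Pa step; pose S := [set t | a <= t <= b /\ P t].
have Sa : S a by split => //; rewrite lexx.
have Sb : ubound S b by move=> t [/andP[]].
have hS : has_sup S by split; [exists a|exists b].
set c := sup S.
have ac : a <= c by exact: ub_le_sup (ex_intro _ b Sb) _ Sa.
have cb : c <= b by exact: ge_sup (ex_intro _ a Sa) Sb.
have [|d d0 dP] := step c; first by rewrite ac.
have [x [/andP[ax xb] Px] cx] := sup_adherent d0 hS.
have xc : x <= c by apply: ub_le_sup (ex_intro _ b Sb) _ _; split => //; rewrite ax.
pose y := Num.min b (c + d / 2).
have cy : c <= y by rewrite le_min cb lerDl divr_ge0// ltW.
have yb : y <= b by rewrite ge_min lexx.
have Py : P y.
  apply: (dP x) => //; rewrite ?ax ?xc ?cy ?yb//; first by rewrite /c; lra.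
  rewrite ltrBlDl gt_min; apply/orP; right; lra.
have yc : y <= c.
  by apply: ub_le_sup (ex_intro _ b Sb) _ _; split => //; rewrite yb (le_trans ac).
have := yc; rewrite ge_min => /orP[bc|]; last by lra.
suff -> : b = y by [].
by apply/le_anti; rewrite yb (le_trans bc cy).
Qed.

(** The scalar form of [abs_continuous_on], which the walk argument handles one
    coordinate at a time. *)
Definition abs_continuous_scalar (a b : R) (f : R -> R) :=
  forall e : R, 0 < e -> exists2 d : R, 0 < d &
  forall s : seq (R * R),
    all (fun p => (a <= p.1) && (p.1 <= p.2) && (p.2 <= b)) s ->
    pairwise (fun p p' => (p.2 <= p'.1) || (p'.2 <= p.1)) s ->
    \sum_(p <- s) (p.2 - p.1) < d ->
    \sum_(p <- s) `|f p.2 - f p.1| < e.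

Lemma is_derive_local_bound (f : R -> R) (t d C : R) :
  is_derive t 1 f d -> `|d| < C ->
  exists2 r, 0 < r & forall z, `|z - t| < r -> `|f z - f t| <= C * `|z - t|.
Proof.
move=> [df <-]; rewrite /derive => dC.
have := df; rewrite /derivable => /cvg_ex[/= l hl].
rewrite (cvg_lim _ hl)// in dC.
have := cvgr_norm_lt l hl _ dC.
move=> [r /= r0 rP]; exists r => // z zr.
have [->|zt] := eqVneq z t; first by rewrite !subrr normr0 mulr0.
have := rP (z - t); rewrite /ball_/= sub0r normrN zr subr_eq0 zt => /(_ isT isT).
rewrite /GRing.scale/= mulr1 subrK normrM normfV mulrC => /ltW.
by rewrite ler_pdivrMr// normr_gt0 subr_eq0.
Qed.

(** Enclose the exceptional null set in an open set U of small measure and walk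
    from a to b in small steps.  A step around a point outside U costs at most
    C + e times its length.  The steps around points of U are disjoint intervals
    inside U, whose total length is small, so absolute continuity makes their
    contribution less than e. *)
Lemma abs_continuous_le (a b C : R) (f g : R -> R) : a <= b -> 0 <= C ->
  abs_continuous_scalar a b f ->
  {ae mu, forall s, a < s < b -> is_derive s 1 f (g s) /\ `|g s| <= C} ->
  `|f b - f a| <= C * (b - a).
Proof.
move=> ab C0 acf [N [mN N0 subN]].
suff H e : 0 < e -> `|f b - f a| <= (C + e) * (b - a) + e.
  apply/ler_addgt0Pr => e e0.
  have ba1 : 0 < b - a + 1 by rewrite ltr_wpDl// subr_ge0.
  have := H (e / (b - a + 1)) (divr_gt0 e0 ba1).
  rewrite mulrDl -addrA -[X in _ + (_ + X)]mulr1 -mulrDr divfK//.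
  by rewrite gt_eqF.
move=> e0; have [d d0 dP] := acf e e0.
(* the endpoints are added because the derivative is only known in between *)
pose M := N `|` ([set a] `|` [set b]).
have mM : measurable M.
  by apply: measurableU => //; apply: measurableU; exact: measurable_set1.
have M0 : mu M = 0%E.
  have s1 (y : R) : measurable ([set y] : set (measurableTypeR R)) := measurable_set1 y.
  have m1 (y : R) : mu [set y] = 0%E by exact: lebesgue_measure_set1.
  have z2 := null_set_setU (s1 a) (s1 b) (m1 a) (m1 b).
  exact: (null_set_setU mN (measurableU _ _ (s1 a) (s1 b)) N0 z2).
have Moo : (mu M < +oo)%E by rewrite M0.
have [U [oU MU UM]] := lebesgue_regularity_outer mM Moo d0.
have mU : measurable (U : set (measurableTypeR R)) by exact: open_measurable.
have mUM : measurable (U `\` M : set (measurableTypeR R)) := measurableD mU mM.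
have muU : (mu U < d%:E)%E.
  have UE : U `\` M `|` M = U by rewrite setUC setDUK.
  have dj : (U `\` M) `&` M = set0 by apply/seteqP; split => // x [[]].
  have E : mu (U `\` M `|` M) = (mu (U `\` M) + mu M)%E := measureU mu mUM mM dj.
  by rewrite -UE E M0 adde0.
have mUI (x y : R) :
    measurable (U `&` `[x, y[%classic : set (measurableTypeR R)).
  by apply: measurableI => //; exact: measurable_itv.
pose len (s : seq (R * R)) := \sum_(p <- s) (p.2 - p.1).
pose var (s : seq (R * R)) := \sum_(p <- s) `|f p.2 - f p.1|.
pose good t := exists s : seq (R * R),
  [/\ all (fun p => (a <= p.1) && (p.1 <= p.2) && (p.2 <= t)) s,
      pairwise (fun p p' => (p.2 <= p'.1) || (p'.2 <= p.1)) s,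
      ((len s)%:E <= mu (U `&` `[a, t[))%E &
      `|f t - f a| <= (C + e) * (t - a) + var s].
suff [s [sab ps ls vs]] : good b.
  apply: (le_trans vs); rewrite lerD2l ltW//; apply: dP => //.
  rewrite -lte_fin; apply: le_lt_trans ls _; apply: le_lt_trans muU.
  apply: le_measure; rewrite ?inE//; exact: mUI.
apply: (@real_induction a b good) => //.
  exists [::]; split => //; rewrite /len /var big_nil ?measure_ge0//.
  by rewrite !subrr normr0 mulr0 addr0.
move=> t /andP[a_t tb].
have widen x y s : x <= y ->
    all (fun p => (a <= p.1) && (p.1 <= p.2) && (p.2 <= x)) s ->
    all (fun p => (a <= p.1) && (p.1 <= p.2) && (p.2 <= y)) s.
  move=> xy; apply: sub_all => p /andP[-> px]; exact: le_trans px xy.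
have [Ut|nUt] := pselect (U t).
  have [r /= r0 rU] : \forall z \near t, U z by exact: oU.
  exists r => // x y /andP[ax xt] /andP[ty yb] xr yr [s [sax ps ls vs]].
  have xy : x <= y := le_trans xt ty.
  exists ((x, y) :: s); split.
  - by rewrite /= ax xy lexx/=; exact: widen sax.
  - rewrite /= ps andbT; apply: sub_all sax => p /andP[_ px].
    by rewrite px orbT.
  - have -> : U `&` `[a, y[ = (U `&` `[a, x[) `|` `[x, y[.
      apply/seteqP; split => z /=; rewrite !in_itv/=.
        move=> [Uz /andP[az zy]]; have [zx|xz] := ltP z x; [left|right].
          by rewrite az.
        by rewrite zy.
      move=> [[Uz /andP[az zx]]|/andP[xz zy]].
        by rewrite az (lt_le_trans zx).
      rewrite zy (le_trans ax)//; split => //; apply: rU => /=.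
      by rewrite /ball_/= ltr_norml; apply/andP; split; lra.
    have mxy : measurable (`[x, y[%classic : set (measurableTypeR R)).
      exact: measurable_itv.
    have dj : U `&` `[a, x[ `&` `[x, y[ = set0.
      rewrite -subset0 => z /= [[_]]; rewrite !in_itv/= => /andP[_ zx] /andP[xz _].
      by have := lt_le_trans zx xz; rewrite ltxx.
    have E : mu (U `&` `[a, x[ `|` `[x, y[) = (mu (U `&` `[a, x[) + mu `[x, y[)%E :=
      measureU mu (mUI a x) mxy dj.
    rewrite E /len big_cons EFinD addeC leeD//=.
    rewrite lebesgue_measure_itv/= lte_fin.
    by case: ltgtP xy => // -> _; rewrite subrr.
  - rewrite /var big_cons /=.
    have := ler_normD (f y - f x) (f x - f a); rewrite subrKA.
    move: vs; rewrite -/(var s).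
    have Ce : 0 <= C + e by rewrite addr_ge0// ltW.
    have : (C + e) * (x - a) <= (C + e) * (y - a).
      by rewrite ler_wpM2l// lerD2r.
    lra.
have nN : ~ N t by move=> Nt; apply/nUt/MU; left.
have ta : t <> a by move=> tE; apply/nUt/MU; right; left.
have tb' : t <> b by move=> tE; apply/nUt/MU; right; right.
have [dft gC] : is_derive t 1 f (g t) /\ `|g t| <= C.
  apply: contrapT => h; apply/nN/subN => /= /(_ _) h'; apply/h/h'.
  by rewrite !lt_neqAle a_t tb !andbT; apply/andP; split; apply/eqP => // /esym.
have [|r r0 rP] := is_derive_local_bound (C := C + e) dft.
  by rewrite (le_lt_trans gC)// ltrDl.
exists r => // x y /andP[ax xt] /andP[ty yb] xr yr [s [sax ps ls vs]].
have xy : x <= y := le_trans xt ty.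
exists s; split => //.
- exact: widen sax.
- apply: le_trans ls _; apply: le_measure; rewrite ?inE; [exact: mUI|exact: mUI|].
  move=> z /= [Uz]; rewrite !in_itv/= => /andP[-> zx]; split => //.
  by rewrite (lt_le_trans zx).
- have := rP x; rewrite distrC (ger0_norm (x := t - x)) ?subr_ge0// => /(_ xr).
  have := rP y; rewrite (ger0_norm (x := y - t)) ?subr_ge0// => /(_ yr).
  have := ler_normD (f y - f t) (f t - f a); rewrite subrKA.
  have := ler_normD (f t - f x) (f x - f a); rewrite subrKA.
  rewrite (distrC (f t) (f x)).
  move: vs; lra.
Qed.
End ac.

(** * Calculus of matrix functions and the matrix exponential *)

Section mxcalc.
Context {R : realType}.

Lemma cvg_mx (m n : nat) (u : nat -> 'M[R]_(m, n)) (L : 'M[R]_(m, n)) :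
  (forall i j, u k i j @[k --> \oo] --> L i j) -> u @ \oo --> L.
Proof.
move=> uL; apply/cvgrPdist_le => e e0; near=> k.
rewrite /Num.Def.normr/= mx_normrE (bigmax_le _ (ltW e0))//= => i _.
rewrite !mxE; move: i; near: k; apply: filter_forall => /= i.
exact: ((cvgrPdist_le _ _).1 (uL i.1 i.2)).
Unshelve. all: by end_near. Qed.

Lemma cvg_sumr (I : Type) (r : seq I) (f : I -> nat -> R) (y : I -> R) :
  (forall i, f i @ \oo --> y i) ->
  (fun k => \sum_(i <- r) f i k) @ \oo --> \sum_(i <- r) y i.
Proof.
move=> fy; elim: r => [|i r IH].
  by rewrite big_nil; under eq_fun do rewrite big_nil; exact: cvg_cst.
rewrite big_cons; under eq_fun do rewrite big_cons.
exact: cvgD.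
Qed.

(** Differentiability entry by entry, for which product and chain rules follow from
    the scalar ones without reference to a norm on matrices. *)
Definition mx_derive (m n : nat) (F : R -> 'M[R]_(m, n)) (t : R) (D : 'M[R]_(m, n)) :=
  forall i j, is_derive t (1 : R) (fun s => F s i j) (D i j).

Lemma mx_deriveM m n p (F : R -> 'M[R]_(m, n)) (G : R -> 'M[R]_(n, p)) t dF dG :
  mx_derive F t dF -> mx_derive G t dG ->
  mx_derive (fun s => F s *m G s) t (dF *m G t + F t *m dG).
Proof.
move=> hF hG i j.
have -> : (fun s => (F s *m G s) i j) =
    \sum_(k < n) ((fun s => F s i k) * (fun s => G s k j)).
  by apply/funext => s; rewrite mxE fct_sumE.
rewrite !mxE -big_split/=.
apply: (@is_derive_sum _ _ _ n (fun k => (fun s => F s i k) * (fun s => G s k j))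
  t 1 (fun k => dF i k * G t k j + F t i k * dG k j)) => k.
rewrite addrC [dF i k * _]mulrC; exact: is_deriveM (hF i k) (hG k j).
Qed.

Lemma mx_derive_cst m n (M : 'M[R]_(m, n)) t : mx_derive (cst M) t 0.
Proof. by move=> i j; rewrite mxE; exact: is_derive_cst. Qed.

Lemma mx_deriveN m n (F : R -> 'M[R]_(m, n)) t dF :
  mx_derive F t dF -> mx_derive (fun s => - F s) t (- dF).
Proof.
move=> hF i j; rewrite mxE.
have -> : (fun s => (- F s) i j) = - (fun s => F s i j).
  by apply/funext => s; rewrite mxE.
exact: is_deriveN.
Qed.

Lemma mx_derive_comp m n (F : R -> 'M[R]_(m, n)) (g : R -> R) t dF dg :
  mx_derive F (g t) dF -> is_derive t 1 g dg ->
  mx_derive (fun s => F (g s)) t (dg *: dF).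
Proof.
move=> hF hg i j; rewrite mxE mulrC.
exact: (@is_derive1_comp _ (fun s => F s i j) g).
Qed.

Lemma mx_derive0_cst m n (F : R -> 'M[R]_(m, n)) s t :
  (forall x, mx_derive F x 0) -> F s = F t.
Proof.
move=> h; apply/matrixP => i j.
apply: (@is_derive_0_is_cst _ (fun s => F s i j)) => x.
by have := h x i j; rewrite mxE.
Qed.

Lemma is_derive_continuous (f : R -> R) (t d : R) :
  is_derive t 1 f d -> {for t, continuous f}.
Proof.
by move=> [df _]; apply: differentiable_continuous; exact/derivable1_diffP.
Qed.

Lemma is_derive_mx_derive m n (F : R -> 'M[R]_(m, n)) (t : R) D :
  is_derive t (1 : R) F D -> mx_derive F t D.
Proof.
move=> [dF <-] i j; split; first exact: (derivable_mxP _ _ _).1.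
by rewrite derive_mx// mxE.
Qed.

End mxcalc.

Section expm.
Context {R : realType}.

(** Coefficients dominated by those of an exponential.  Such power series converge
    everywhere, and the class is stable under termwise differentiation. *)
Definition fact_bounded (c : nat -> R) :=
  exists C a : R, [/\ 0 <= C, 0 <= a & forall k, `|c k| <= C * a ^+ k / k`!%:R].

Lemma fact_bounded_cvg (c : nat -> R) x : fact_bounded c -> cvgn (pseries c x).
Proof.
move=> [C [a [C0 a0 ca]]]; apply: normed_cvg.
apply: (@series_le_cvg _ _ (fun k => C * ((a * `|x|) ^+ k / k`!%:R))).
- by move=> k; rewrite normr_ge0.
- by move=> k; rewrite mulr_ge0// divr_ge0// exprn_ge0// mulr_ge0.
- move=> k /=; rewrite normrM normrX exprMn.
  rewrite (_ : C * _ = C * a ^+ k / k`!%:R * `|x| ^+ k); last by ring.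
  by rewrite ler_wpM2r// exprn_ge0.
- exact: (@is_cvg_seriesZ _ _ C (is_cvg_series_exp_coeff _)).
Qed.

Lemma fact_bounded_diffs c : fact_bounded c -> fact_bounded (pseries_diffs c).
Proof.
move=> [C [a [C0 a0 ca]]]; exists (C * a), a; split=> //; first exact: mulr_ge0.
move=> k; rewrite /pseries_diffs normrM ger0_norm//.
apply: (@le_trans _ _ (k.+1%:R * (C * a ^+ k.+1 / k.+1`!%:R))).
  by rewrite ler_wpM2l.
rewrite factS natrM exprS invfM.
rewrite [leLHS](_ : _ = C * a * a ^+ k / k`!%:R)//.
transitivity ((k.+1%:R / k.+1%:R) * (C * a * a ^+ k / k`!%:R)); last first.
  by rewrite mulfV ?pnatr_eq0// mul1r.
by move: (k.+1%:R^-1) (k`!%:R^-1) => y z; ring.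
Qed.

Lemma fact_bounded_derive c x : fact_bounded c ->
  is_derive x (1 : R) (fun t => limn (pseries c t)) (limn (pseries (pseries_diffs c) x)).
Proof.
move=> h; apply: (@pseries_snd_diffs _ c (`|x| + 1)).
- exact: fact_bounded_cvg.
- by apply: fact_bounded_cvg; exact: fact_bounded_diffs.
- by apply: fact_bounded_cvg; do 2!apply: fact_bounded_diffs.
- by rewrite [ltRHS]ger0_norm ?addr_ge0// ltrDl.
Qed.

Context {n : nat} (A : 'M[R]_n).

Let c i j k : R := k`!%:R^-1 * (A ^+ k) i j.
Let a : R := 1 + \sum_(i < n) \sum_(j < n) `|A i j|.

Let a1 : 1 <= a.
Proof. by rewrite lerDl sumr_ge0// => i _; exact: sumr_ge0. Qed.

Let powA i j k : `|(A ^+ k) i j| <= a ^+ k.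
Proof.
have a0 : 0 <= a := le_trans ler01 a1.
elim: k i j => [|k IH] i j.
  rewrite expr0 expr0 [1]/(1%:M) mxE.
  by case: eqP => _; rewrite ?normr1// normr0.
rewrite exprS [A * _]/(A *m _) mxE (le_trans (ler_norm_sum _ _ _))//.
apply: (@le_trans _ _ (\sum_(l < n) `|A i l| * a ^+ k)).
  by apply: ler_sum => l _; rewrite normrM ler_wpM2l.
rewrite -mulr_suml [leRHS]exprS ler_wpM2r ?exprn_ge0//.
rewrite /a [X in _ <= 1 + X](bigD1 i)//= addrCA lerDl.
by rewrite addr_ge0// sumr_ge0// => i' _; exact: sumr_ge0.
Qed.

Let c_bounded i j : fact_bounded (c i j).
Proof.
exists 1, a; split => //; first exact: le_trans a1.
move=> k; rewrite /c normrM mul1r mulrC ler_pM//.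
by rewrite ger0_norm ?invr_ge0.
Qed.

Let cdiffs i j k : pseries_diffs (c i j) k = \sum_l A i l * c l j k.
Proof.
rewrite /pseries_diffs /c exprS [A * _]/(A *m _) mxE factS natrM invfM.
rewrite mulrA mulrA mulfV ?pnatr_eq0// mul1r mulr_sumr.
by apply: eq_bigr => l _; ring.
Qed.

Let cdiffs' i j k : pseries_diffs (c i j) k = \sum_l c i l k * A l j.
Proof.
rewrite /pseries_diffs /c exprSr [_ * A]/(_ *m A) mxE factS natrM invfM.
rewrite mulrA mulrA mulfV ?pnatr_eq0// mul1r mulr_sumr.
by apply: eq_bigr => l _; ring.
Qed.

Let exprZmx t k : (t *: A) ^+ k = t ^+ k *: A ^+ k.
Proof.
elim: k => [|k IH]; first by rewrite !expr0 scale1r.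
rewrite !exprS IH.
change ((t *: A) *m (t ^+ k *: A ^+ k) = (t * t ^+ k) *: (A *m A ^+ k)).
by rewrite -scalemxAl -scalemxAr scalerA.
Qed.

Lemma expm_pseries t :
  expm (t *: A) = \matrix_(i, j) limn (pseries (c i j) t).
Proof.
apply: norm_cvg_lim; apply: cvg_mx => i j; rewrite mxE.
rewrite (_ : (fun k => _) = pseries (c i j) t); first exact: fact_bounded_cvg.
apply/funext => N; rewrite /series /pseries/= summxE.
by apply: eq_bigr => k _; rewrite exprZmx !mxE /c; ring.
Qed.

Let lim_diffs i j t : limn (pseries (pseries_diffs (c i j)) t) =
  (A *m expm (t *: A)) i j.
Proof.
apply/cvg_lim => //; rewrite mxE expm_pseries.
rewrite (_ : pseries _ _ = fun N => \sum_l A i l * pseries (c l j) t N).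
  apply: cvg_sumr => l; rewrite mxE.
  by apply: cvgM; [exact: cvg_cst|exact: fact_bounded_cvg].
apply/funext => N; rewrite /pseries /series/=.
under [RHS]eq_bigr do rewrite mulr_sumr.
rewrite exchange_big/=; apply: eq_bigr => k _.
by rewrite cdiffs mulr_suml; apply: eq_bigr => l _; rewrite mulrA.
Qed.

Let lim_diffs' i j t : limn (pseries (pseries_diffs (c i j)) t) =
  (expm (t *: A) *m A) i j.
Proof.
apply/cvg_lim => //; rewrite mxE expm_pseries.
rewrite (_ : pseries _ _ = fun N => \sum_l pseries (c i l) t N * A l j).
  apply: cvg_sumr => l; rewrite mxE.
  by apply: cvgM; [exact: fact_bounded_cvg|exact: cvg_cst].
apply/funext => N; rewrite /pseries /series/=.
under [RHS]eq_bigr do rewrite mulr_suml.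
rewrite exchange_big/=; apply: eq_bigr => k _.
by rewrite cdiffs' mulr_suml; apply: eq_bigr => l _; rewrite mulrAC.
Qed.

Lemma expm_comm t : expm (t *: A) *m A = A *m expm (t *: A).
Proof. by apply/matrixP => i j; rewrite -lim_diffs -lim_diffs'. Qed.

Lemma expm_derive t : mx_derive (fun s => expm (s *: A)) t (A *m expm (t *: A)).
Proof.
move=> i j; rewrite -lim_diffs.
under eq_fun do rewrite expm_pseries mxE.
exact: fact_bounded_derive.
Qed.

(** Termwise integration of the exponential series.  A primitive turns every
    integral of the exponential into an increment. *)
Lemma expm_primitive : exists P : R -> 'M[R]_n,
  forall t, mx_derive P t (expm (t *: A)).
Proof.
pose p i j k : R := if k is k'.+1 then c i j k' / k%:R else 0.
exists (fun t => \matrix_(i, j) limn (pseries (p i j) t)) => t i j.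
under eq_fun do rewrite mxE.
rewrite expm_pseries mxE (_ : c i j = pseries_diffs (p i j)); last first.
  by apply/funext => k; rewrite /pseries_diffs /p mulrC divfK// pnatr_eq0.
apply: fact_bounded_derive; exists 1, a; split => //; first exact: le_trans a1.
have a0 : 0 <= a := le_trans ler01 a1.
move=> [|k]; rewrite /p mul1r ?normr0 ?divr_ge0 ?exprn_ge0//.
have -> : `|c i j k / k.+1%:R| = `|(A ^+ k) i j| / k.+1`!%:R.
  rewrite /c !normrM !normfV !normr_nat factS natrM invfM.
  rewrite -mulrA mulrCA; congr (_ * _); exact: mulrC.
rewrite ler_wpM2r ?invr_ge0// (le_trans (powA i j k))//.
by rewrite exprS ler_peMl// exprn_ge0.
Qed.

Lemma expm0 : expm (0 *: A) = 1%:M.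
Proof.
rewrite expm_pseries; apply/matrixP => i j; rewrite mxE.
apply/cvg_lim => //; rewrite -cvg_shiftS.
rewrite (_ : (fun k => _) = cst ((1%:M : 'M[R]_n) i j)); first exact: cvg_cst.
apply/funext => N; rewrite /pseries /series /= big_nat_recl//= big1 => [|k _].
  by rewrite /c fact0 invr1 !expr0 addr0 mul1r mulr1.
by rewrite expr0n mulr0.
Qed.

Lemma expmN_derive t :
  mx_derive (fun s => expm (- s *: A)) t (- (A *m expm (- t *: A))).
Proof.
rewrite -scaleN1r; apply: (mx_derive_comp (F := fun s => expm (s *: A)) (g := -%R)).
exact: expm_derive.
Qed.

(** The left-hand side has zero derivative in s. *)
Lemma expmDN s t : expm ((s + t) *: A) *m expm (- s *: A) = expm (t *: A).
Proof.
rewrite (@mx_derive0_cst _ _ _ (fun s => expm ((s + t) *: A) *m expm (- s *: A)) s 0).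
  by rewrite add0r oppr0 expm0 mulmx1.
move=> x.
have d1 := mx_derive_comp (F := fun s => expm (s *: A)) (g := shift t)
  (expm_derive (x + t)) (is_derive_shift x 1 t).
have := mx_deriveM d1 (expmN_derive x).
rewrite scale1r mulmxN mulmxA expm_comm subrr. exact.
Qed.

Lemma expmKN s : expm (s *: A) *m expm (- s *: A) = 1%:M.
Proof. by rewrite -expm0 -(expmDN s 0) addr0. Qed.

Lemma expmNK s : expm (- s *: A) *m expm (s *: A) = 1%:M.
Proof. by rewrite -[in X in _ *m X](opprK s) expmKN. Qed.

Lemma expmD s t : expm ((s + t) *: A) = expm (t *: A) *m expm (s *: A).
Proof. by rewrite -[LHS]mulmx1 -(expmNK s) mulmxA expmDN. Qed.

End expm.

(** * Powers of a Schur matrix *)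

Section decay.
Context {K : numFieldType}.

(** A rate strictly above that of the homogeneous part absorbs the forcing term. *)
Lemma decay_rate_above (a r : K) : 0 <= a -> a < 1 -> 0 <= r -> r < 1 ->
  exists s : K, [/\ a < s, r <= s & s < 1].
Proof.
move=> a0 a1 r0 r1.
have a1' : 0 < 1 - a by rewrite subr_gt0.
have r1' : 0 < 1 - r by rewrite subr_gt0.
(* a and r need not be comparable in a partially ordered field, hence this
   mean in place of their maximum *)
pose s := 1 - (1 - a) * (1 - r) / 2; exists s; split.
- rewrite -subr_gt0 (_ : s - a = (1 - a) * (1 + r) / 2); last by rewrite /s; field.
  by rewrite divr_gt0// mulr_gt0// ltr_wpDr.
- rewrite -subr_ge0 (_ : s - r = (1 - r) * (1 + a) / 2); last by rewrite /s; field.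
  by rewrite divr_ge0// mulr_ge0 ?(ltW r1')// addr_ge0.
- by rewrite /s ltrBlDr ltrDl divr_gt0// mulr_gt0.
Qed.

Lemma affine_recursion_decay (lam : K) (w g : nat -> K) (W C r s : K) :
  0 <= r -> 0 <= C -> `|lam| < s -> r <= s -> `|w 0%N| <= W ->
  (forall k, `|g k| <= C * r ^+ k) ->
  (forall k, w k.+1 = lam * w k + g k) ->
  forall k, `|w k| <= (W + C / (s - `|lam|)) * s ^+ k.
Proof.
move=> r0 C0 ls rs w0 gC wS.
have W0 : 0 <= W := le_trans (normr_ge0 _) w0.
have s0 : 0 <= s := le_trans r0 rs.
have ls' : 0 < s - `|lam| by rewrite subr_gt0.
elim=> [|k IH].
  by rewrite expr0 mulr1 (le_trans w0)// lerDl divr_ge0// ltW.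
rewrite wS (le_trans (ler_normD _ _))// normrM.
apply: le_trans (lerD (ler_wpM2l (normr_ge0 lam) IH) (gC k)) _.
have rk : C * r ^+ k <= C * s ^+ k by rewrite ler_wpM2l// lerXn2r.
apply: le_trans (lerD (lexx _) rk) _.
rewrite mulrA -mulrDl exprS mulrA ler_wpM2r ?exprn_ge0//.
rewrite -lerBrDl [`|lam| * _]mulrC -mulrBr mulrDl divfK ?gt_eqF// lerDr.
by rewrite mulr_ge0// ltW.
Qed.

Context {n : nat}.

Definition mx_decay (W : nat -> 'M[K]_n) := exists C r : K,
  [/\ 0 <= C, 0 <= r, r < 1 & forall k i j, `|W k i j| <= C * r ^+ k].

(** This peels one factor X - lam off a polynomial that annihilates a matrix. *)
Lemma mx_decay_recursion (lam : K) (W : nat -> 'M[K]_n) : `|lam| < 1 ->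
  mx_decay (fun k => W k.+1 - lam *: W k) -> mx_decay W.
Proof.
move=> l1 [C [r [C0 r0 r1 WC]]].
have [s [ls rs s1]] := decay_rate_above (normr_ge0 lam) l1 r0 r1.
pose W0 := \sum_i \sum_j `|W 0%N i j|.
have W00 : 0 <= W0 by apply: sumr_ge0 => i _; exact: sumr_ge0.
exists (W0 + C / (s - `|lam|)), s; split => //.
- by rewrite addr_ge0// divr_ge0// subr_ge0 ltW.
- exact: le_trans rs.
- move=> k i j.
  apply: (affine_recursion_decay (g := fun k => (W k.+1 - lam *: W k) i j)
    (w := fun k => W k i j) r0 C0 ls rs) => //.
    rewrite /W0 (bigD1 i)//= (bigD1 j)//= -addrA lerDl addr_ge0//.
      exact: sumr_ge0.
    by apply: sumr_ge0 => i' _; exact: sumr_ge0.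
  by move=> k'; rewrite !mxE addrCA subrr addr0.
Qed.
End decay.

(** By Cayley-Hamilton the product of the F - z over the eigenvalues z vanishes, in
    particular it decays after multiplication by the powers of F.  Removing the
    factors one by one keeps geometric decay, since each |z| < 1. *)
Lemma mx_decay_powers (K : numClosedFieldType) (n : nat) (F : 'M[K]_n.+1) :
  (forall z, eigenvalue F z -> `|z| < 1) -> mx_decay (fun k => F ^+ k).
Proof.
move=> F1.
have H (s : seq K) : (forall z, z \in s -> `|z| < 1) -> forall q : {poly K},
  mx_decay (fun k => F ^+ k * horner_mx F (q * \prod_(z <- s) ('X - z%:P))) ->
  mx_decay (fun k => F ^+ k * horner_mx F q).
  elim: s => [|z s IH] s1 q; first by rewrite big_nil mulr1.
  rewrite big_cons mulrA => /IH h.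
  apply: (@mx_decay_recursion _ _ z); first by apply: s1; rewrite mem_head.
  have [|C [r [C0 r0 r1 WC]]] := h _.
    by move=> y ys; apply: s1; rewrite inE ys orbT.
  exists C, r; split => // k i j; apply: le_trans (WC k i j).
  rewrite le_eqVlt; apply/orP; left; apply/eqP; congr `|_|.
  congr (fun_of_matrix _ i j).
  rewrite rmorphM rmorphB/= horner_mx_X horner_mx_C mulrA mulrBr.
  congr (_ - _); last exact: esym (mul_mx_scalar _ _).
  by rewrite exprSr -!mulrA; congr (_ * _); exact: comm_mx_horner.
have [rs rsE] := closed_field_poly_normal (char_poly F).
rewrite (monicP (char_poly_monic F)) scale1r in rsE.
have /H/(_ 1) : forall z, z \in rs -> `|z| < 1.
  by move=> z zrs; apply: F1; rewrite eigenvalue_root_char rsE root_prod_XsubC.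
rewrite mul1r -rsE Cayley_Hamilton rmorph1.
have -> : (fun k => F ^+ k * 1) = (fun k => F ^+ k).
  by apply/funext => k; rewrite mulr1.
apply; exists 0, 0; split => // k i j.
by rewrite mulr0 mxE normr0 mul0r.
Qed.

Lemma schur_powers (R : realType) (n : nat) (F : 'M[R]_n) :
  (forall z : R[i], eigenvalue (map_mx (real_complex R) F) z -> `|z| < 1) ->
  exists C r : R, [/\ 0 <= C, 0 < r, r < 1 &
    forall k i j, `|(F ^+ k) i j| <= C * r ^+ k].
Proof.
case: n F => [|n] F.
  move=> _; exists 0, (2^-1); split => //.
    by rewrite invf_lt1// ltr1n.
  by move=> k [].
move=> /mx_decay_powers [C [r [C0 r0 r1 FC]]].
have CE : C = (complex.Re C)%:C%C by rewrite RRe_real// ger0_real.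
have rE : r = (complex.Re r)%:C%C by rewrite RRe_real// ger0_real.
pose c := complex.Re C; pose s := complex.Re r.
have c0 : 0 <= c by rewrite -ler0c -CE.
have s0 : 0 <= s by rewrite -ler0c -rE.
have s1 : s < 1 by rewrite -ltcR -rE.
exists c, ((1 + s) / 2); split => //; [lra|lra|move=> k i j].
apply: (@le_trans _ _ (c * s ^+ k)); last first.
  by rewrite ler_wpM2l// lerXn2r// ?nnegrE//; lra.
rewrite -lecR; have := FC k i j.
have -> : map_mx (real_complex R) F ^+ k = map_mx (real_complex R) (F ^+ k).
  by rewrite rmorphXn.
rewrite mxE CE rE -rmorphXn -rmorphM; apply: le_trans.
exact: (normc_ge_Re (((F ^+ k) i j)%:C)%C).
Qed.

(** * Norms and integrals of matrix functions *)

Section norms.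
Context {R : realType}.

Lemma mxnorm_le m n (A : 'M[R]_(m, n)) (c : R) : 0 <= c ->
  (forall i j, `|A i j| <= c) -> `|A| <= c.
Proof.
move=> c0 Ac; rewrite /Num.Def.normr/= mx_normrE (bigmax_le _ c0)//= => i _; exact: Ac.
Qed.

Lemma mxnorm_entry m n (A : 'M[R]_(m, n)) i j : `|A i j| <= `|A|.
Proof.
rewrite [leRHS]/Num.Def.normr/= mx_normrE.
exact: (le_bigmax _ (fun ij => `|A ij.1 ij.2|) (i, j)).
Qed.

Lemma mxnormM m n p (A : 'M[R]_(m, n)) (B : 'M[R]_(n, p)) :
  `|A *m B| <= n%:R * `|A| * `|B|.
Proof.
apply: mxnorm_le => [|i j]; first by rewrite !mulr_ge0.
rewrite mxE (le_trans (ler_norm_sum _ _ _))//.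
apply: (@le_trans _ _ (\sum_(k < n) `|A| * `|B|)).
  by apply: ler_sum => k _; rewrite normrM ler_pM// mxnorm_entry.
by rewrite sumr_const card_ord -[leLHS]mulr_natl mulrA.
Qed.

Lemma mxnormM_le m n p (A : 'M[R]_(m, n)) (B : 'M[R]_(n, p)) (a b : R) :
  `|A| <= a -> `|B| <= b -> `|A *m B| <= n%:R * a * b.
Proof.
move=> Aa Bb; apply: le_trans (mxnormM _ _) _.
by rewrite ler_pM// ?mulr_ge0// ler_wpM2l.
Qed.

Lemma mxnorm_le_enorm n (v : 'cV[R]_n) : `|v| <= enorm v.
Proof.
apply: mxnorm_le; first exact: sqrtr_ge0.
move=> i j; rewrite ord1 /enorm -sqrtr_sqr ler_sqrt; last first.
  by apply: sumr_ge0 => k _; exact: sqr_ge0.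
by rewrite (bigD1 i)//= lerDl sumr_ge0// => k _; exact: sqr_ge0.
Qed.

Lemma enorm_le_mxnorm n (v : 'cV[R]_n) : enorm v <= n%:R * `|v|.
Proof.
rewrite /enorm -[leRHS]ger0_norm ?mulr_ge0// -sqrtr_sqr ler_wsqrtr//.
apply: (@le_trans _ _ (\sum_(i < n) `|v| ^+ 2)).
  by apply: ler_sum => i _; rewrite -real_normK ?num_real// lerXn2r ?nnegrE ?mxnorm_entry.
rewrite sumr_const card_ord -[leLHS]mulr_natl exprMn ler_wpM2r ?sqr_ge0//.
by case: n v => [|n] v; rewrite ?expr0n// expr2 ler_peMl ?ler1n.
Qed.

Lemma enorm0_entry n (v : 'cV[R]_n) i : `|v i 0| <= enorm v.
Proof. exact: le_trans (mxnorm_entry _ _ _) (mxnorm_le_enorm _). Qed.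

End norms.

Section lipschitz.
Context {R : realType}.
Notation mu := (@lebesgue_measure R).

Definition lipschitz_on m n (a b L : R) (F : R -> 'M[R]_(m, n)) :=
  forall s t, a <= s <= b -> a <= t <= b -> `|F s - F t| <= L * `|s - t|.

(** [Rintegral_lipschitz] entry by entry. *)
Lemma mint_lipschitz m n (a b L : R) (F G : R -> 'M[R]_(m, n)) : a <= b ->
  lipschitz_on a b L G ->
  {ae mu, forall s, a < s < b -> mx_derive G s (F s)} ->
  mint a b F = G b - G a.
Proof.
move=> ab GL GF; apply/matrixP => i j; rewrite !mxE.
apply: (@Rintegral_lipschitz _ _ _ L (fun s => G s i j)) => //.
  move=> s t sab tab; apply: le_trans (GL _ _ sab tab).
  by have := mxnorm_entry (G s - G t) i j; rewrite !mxE.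
by move: GF; apply: (filterS (Filter := ae_filter_ringOfSetsType mu)) => s h /h.
Qed.

Lemma mxnorm_mint_le m n (a b C : R) (F : R -> 'M[R]_(m, n)) : a <= b -> 0 <= C ->
  (forall s, a < s < b -> `|F s| <= C) -> `|mint a b F| <= C * (b - a).
Proof.
move=> ab C0 FC; apply: mxnorm_le => [|i j].
  by rewrite mulr_ge0// subr_ge0.
rewrite mxE; apply: normr_Rintegral_le => // s /FC.
by apply: le_trans; exact: mxnorm_entry.
Qed.

Lemma continuous_itv_bounded (a b : R) (f : R -> R) : continuous f ->
  exists2 C, 0 <= C & forall s, a <= s <= b -> `|f s| <= C.
Proof.
move=> cf; have [ab|ba] := leP a b; last first.
  by exists 0 => // s /andP[a_s sb];
    have := lt_le_trans ba (le_trans a_s sb); rewrite ltxx.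
have [|c cab fc] := @EVT_max _ (fun s => `|f s|) a b ab.
  apply: continuous_subspaceT => s; apply: continuous_comp; first exact: cf.
  exact: norm_continuous.
by exists `|f c| => // s sab; apply: fc; rewrite in_itv.
Qed.

Lemma mx_continuous_itv_bounded m n (a b : R) (F : R -> 'M[R]_(m, n)) :
  (forall i j, continuous (fun s => F s i j)) ->
  exists2 C, 0 <= C & forall s, a <= s <= b -> `|F s| <= C.
Proof.
move=> cF.
have /fin_all_exists [C CP] : forall ij : 'I_m * 'I_n, exists C : R, 0 <= C /\
    forall s, a <= s <= b -> `|F s ij.1 ij.2| <= C.
  by move=> [i j]; have [C C0 CP] := continuous_itv_bounded a b (cF i j); exists C.
have C0 : 0 <= \sum_ij C ij by apply: sumr_ge0 => ij _; have [] := CP ij.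
exists (\sum_ij C ij) => // s sab; apply: mxnorm_le => // i j.
apply: le_trans ((CP (i, j)).2 s sab) _.
by rewrite (bigD1 (i, j))//= lerDl sumr_ge0// => ij _; have [] := CP ij.
Qed.

Lemma mx_derive_lipschitz m n (a b : R) (F G : R -> 'M[R]_(m, n)) :
  (forall s, mx_derive G s (F s)) -> (forall i j, continuous (fun s => F s i j)) ->
  exists2 L, 0 <= L & lipschitz_on a b L G.
Proof.
move=> GF cF; have [L L0 FL] := mx_continuous_itv_bounded a b cF.
exists L => // s t sab tab; apply: mxnorm_le => [|i j]; first by rewrite mulr_ge0.
rewrite !mxE; move: sab tab; wlog st : s t / s < t.
  move=> wl; have [/wl//|/wl h sab tab|->] := ltgtP s t.
    by rewrite distrC (distrC s); exact: h.
  by rewrite !subrr !normr0 mulr0.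
move=> /andP[a_s sb] /andP[a_t tb].
have [||c] := @MVT _ (fun s => G s i j) (fun s => F s i j) s t st.
- by move=> x _; exact: GF.
- by apply: continuous_subspaceT => x; exact: is_derive_continuous (GF x i j).
rewrite in_itv/= => /andP[sc ct] E; rewrite distrC E normrM (distrC t).
rewrite ler_wpM2r// (le_trans (mxnorm_entry _ _ _))// FL//.
by rewrite (le_trans a_s (ltW sc)) (le_trans (ltW ct) tb).
Qed.

Lemma mint_continuous m n (a b : R) (F G : R -> 'M[R]_(m, n)) : a <= b ->
  (forall s, mx_derive G s (F s)) -> (forall i j, continuous (fun s => F s i j)) ->
  mint a b F = G b - G a.
Proof.
move=> ab GF cF; have [L L0 GL] := mx_derive_lipschitz a b GF cF.
by apply: (mint_lipschitz ab GL); apply: aeW => s _; exact: GF.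
Qed.

End lipschitz.

(** * Variation of constants *)

Section dynamics.
Context {R : realType}.
Notation mu := (@lebesgue_measure R).

Lemma abs_continuous_scalarS (a b s t : R) (f : R -> R) : a <= s -> t <= b ->
  abs_continuous_scalar a b f -> abs_continuous_scalar s t f.
Proof.
move=> a_s tb acf e /acf[d d0 dP]; exists d => // l lst; apply: dP.
apply: sub_all lst => p /andP[/andP[sp ->] pt].
by rewrite (le_trans a_s sp) (le_trans pt tb).
Qed.

Lemma abs_continuous_on_entry n (a b : R) (x : R -> 'cV[R]_n) k :
  abs_continuous_on a b x -> abs_continuous_scalar a b (fun t => x t k 0).
Proof.
move=> acx e /acx[d d0 dP]; exists d => // l lab pl dl.
apply: le_lt_trans (dP l lab pl dl); apply: ler_sum => p _.
by have := enorm0_entry (x p.2 - x p.1) k; rewrite !mxE.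
Qed.

Lemma abs_continuous_bounded (a b : R) (f : R -> R) : a <= b ->
  abs_continuous_scalar a b f -> exists C, forall s, a <= s <= b -> `|f s| <= C.
Proof.
move=> ab acf; have [d d0 dP] := acf 1 ltr01.
apply: (@real_induction _ a b (fun t => exists C, forall s, a <= s <= t -> `|f s| <= C)) => //.
  by exists `|f a| => s as_; rewrite (@le_anti _ _ s a)// andbC.
move=> t _; exists (d / 2); first by rewrite divr_gt0.
move=> y z /andP[ay yt] /andP[tz zb] yd zd [C CP]; exists (C + 1) => s /andP[as_ sz].
have [sy|ys] := leP s y; first by rewrite (le_trans (CP s _)) ?as_// lerDl.
have := dP [:: (y, s)]; rewrite /= !big_seq1/= ay (ltW ys) (le_trans sz zb).
have sy : s - y < d by lra.
move=> /(_ isT isT sy) fd; have := ler_normD (f y) (f s - f y).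
have := CP y; rewrite lexx ay => /(_ isT).
by rewrite [f y + _]addrC subrK; lra.
Qed.

Context {n m : nat} (A : 'M[R]_n) (B : 'M[R]_(n, m)) (tau : R).
Implicit Types (x : R -> 'cV[R]_n) (u : R -> 'cV[R]_m).

(** On a compact interval the state is bounded, hence so is the right-hand side of
    the equation, and [abs_continuous_le] applies to each coordinate. *)
Lemma trajectory_lipschitz x u (s t U : R) : delay_ode A B tau x u ->
  0 <= s -> s <= t -> 0 <= U -> (forall w : R, s < w < t -> `|u (w - tau)| <= U) ->
  exists L, lipschitz_on s t L x.
Proof.
move=> [acx dx] s0 st U0 uU.
have t0 : 0 <= t := le_trans s0 st.
have acs k : abs_continuous_scalar s t (fun z => x z k 0).
  exact: abs_continuous_scalarS s0 (lexx t) (abs_continuous_on_entry k (acx t t0)).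
have /fin_all_exists [C CP] k : exists C, forall z, s <= z <= t -> `|x z k 0| <= C.
  exact: abs_continuous_bounded.
have C0 k : 0 <= C k by rewrite (le_trans (normr_ge0 (x s k 0)))// CP// lexx.
pose X := \sum_k C k.
have X0 : 0 <= X by exact: sumr_ge0.
have xX z : s <= z <= t -> `|x z| <= X.
  move=> szt; apply: mxnorm_le => // k j; rewrite ord1.
  by apply: (le_trans (CP k z szt)); rewrite /X (bigD1 k)//= lerDl sumr_ge0.
pose L := n%:R * `|A| * X + m%:R * `|B| * U.
have L0 : 0 <= L by rewrite addr_ge0// !mulr_ge0.
exists L.
suff H w z : s <= w -> w <= z -> z <= t -> `|x z - x w| <= L * (z - w).
  move=> w z /andP[sw wt] /andP[sz zt]; have [wz|/ltW zw] := leP w z.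
    by rewrite distrC [`|w - z|]distrC [`|z - w|]ger0_norm ?subr_ge0// H.
  by rewrite [`|w - z|]ger0_norm ?subr_ge0// H.
move=> sw wz zt; apply: mxnorm_le => [|k j]; first by rewrite mulr_ge0// subr_ge0.
rewrite ord1 !mxE.
apply: (@abs_continuous_le _ w z L (fun y => x y k 0)
  (fun y => (A *m x y + B *m u (y - tau)) k 0)) => //.
  exact: abs_continuous_scalarS (acs k).
move: dx; apply: (filterS (Filter := ae_filter_ringOfSetsType mu)) => y dy /andP[wy yz].
have sy : s < y := le_lt_trans sw wy.
have yt : y < t := lt_le_trans yz zt.
split; first exact: is_derive_mx_derive (dy (le_trans s0 (ltW sy))) k 0.
rewrite (le_trans (mxnorm_entry _ _ _))// (le_trans (ler_normD _ _))//.
by apply: lerD; apply: mxnormM_le; rewrite ?xX ?(ltW sy) ?(ltW yt)// uU// sy yt.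
Qed.

Lemma expmN_continuous i j : continuous (fun s : R => expm (- s *: A) i j).
Proof. by move=> s; apply: is_derive_continuous; exact: expmN_derive. Qed.

Lemma expmN_lipschitz (a b : R) :
  exists2 L, 0 <= L & lipschitz_on a b L (fun s : R => expm (- s *: A)).
Proof.
apply: mx_derive_lipschitz; first exact: expmN_derive.
move=> i j s; apply: is_derive_continuous.
have := mx_deriveN (mx_deriveM (mx_derive_cst A s) (expmN_derive A s)).
exact.
Qed.

(** Variation of constants: s |-> exp(-As) x(c + s) is Lipschitz and its derivative
    is almost everywhere exp(-As) B u(c - tau + s).  The integrand F may differ from
    this at the endpoints, so that a zero order hold, constant on half-open
    intervals, can be inserted. *)
Lemma duhamel x u (F : R -> 'cV[R]_n) (c a b U : R) : delay_ode A B tau x u ->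
  0 <= c + a -> a <= b -> 0 <= U ->
  (forall w : R, c + a < w < c + b -> `|u (w - tau)| <= U) ->
  (forall s, a < s < b -> F s = expm (- s *: A) *m B *m u (c - tau + s)) ->
  mint a b F =
  expm (- b *: A) *m x (c + b) - expm (- a *: A) *m x (c + a).
Proof.
move=> ode ca0 ab U0 uU FE.
have cab : c + a <= c + b by rewrite lerD2l.
have [Lx xL] := trajectory_lipschitz ode ca0 cab U0 uU.
have [Le Le0 eL] := expmN_lipschitz a b.
have [Ce Ce0 eC] := mx_continuous_itv_bounded a b expmN_continuous.
have shift_in s : a <= s <= b -> c + a <= c + s <= c + b by rewrite !lerD2l.
have {}xL : lipschitz_on (c + a) (c + b) `|Lx| x.
  move=> s t sab tab; apply: (le_trans (xL s t sab tab)).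
  by rewrite ler_wpM2r// ler_norm.
pose X := `|x (c + a)| + `|Lx| * (b - a).
have X0 : 0 <= X by rewrite addr_ge0// mulr_ge0// subr_ge0.
have xX s : a <= s <= b -> `|x (c + s)| <= X.
  move=> sab; have [as_ sb] := andP sab.
  have := xL (c + s) (c + a); rewrite lexx cab !lerD2l as_ sb => /(_ isT isT) h.
  rewrite -[x (c + s)](subrK (x (c + a))) addrC (le_trans (ler_normD _ _))// lerD2l.
  apply: (le_trans h); rewrite opprD addrACA subrr add0r.
  by rewrite ler_wpM2l// ger0_norm ?subr_ge0// lerD2r.
apply: (@mint_lipschitz _ _ _ a b (n%:R * Ce * `|Lx| + n%:R * Le * X) _
  (fun s => expm (- s *: A) *m x (c + s))) => //.
  move=> s t sab tab.
  rewrite [X in `|X|](_ : _ = expm (- s *: A) *m (x (c + s) - x (c + t))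
      + (expm (- s *: A) - expm (- t *: A)) *m x (c + t)); last first.
    by rewrite mulmxBr mulmxBl addrA subrK.
  have h1 : `|x (c + s) - x (c + t)| <= `|Lx| * `|s - t|.
    apply: (le_trans (xL _ _ (shift_in s sab) (shift_in t tab))).
    by rewrite opprD addrACA subrr add0r.
  have h2 := mxnormM_le (eL s t sab tab) (xX t tab).
  apply: (le_trans (ler_normD _ _)).
  apply: (le_trans (lerD (mxnormM_le (eC s sab) h1) h2)).
  by rewrite le_eqVlt; apply/orP; left; apply/eqP; ring.
have [_ dx] := ode.
have := ae_shift c dx.
apply: (filterS (Filter := ae_filter_ringOfSetsType mu)) => s dxs sab.
rewrite FE//; have [as_ sb] := andP sab.
have {}dxs := is_derive_mx_derive (dxs _).
have sc0 : 0 <= s + c by rewrite addrC (le_trans ca0)// lerD2l ltW.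
have := mx_derive_comp (g := shift c) (dxs sc0) (is_derive_shift s 1 c).
rewrite scale1r => dxc; have := mx_deriveM (expmN_derive A s) dxc.
rewrite (_ : _ + _ = expm (- s *: A) *m B *m u (c - tau + s)).
  by under [X in mx_derive X]eq_fun do rewrite /= addrC.
rewrite /= mulmxDr mulNmx -expm_comm !mulmxA addrA addNr add0r.
by rewrite [c - tau + s]addrC addrA.
Qed.

End dynamics.

(** * The closed bounded_loop *)

Section state_growth.
Context {R : realType} {n m : nat} (A : 'M[R]_n) (B : 'M[R]_(n, m)) (tau : R).

(** [duhamel] over a time span of at most L, multiplied by the exponential to
    solve for the final state; C depends on A, B and L only. *)
Lemma state_growth (L : R) : 0 <= L -> exists2 C, 0 <= C &
  forall x u (s t U : R), delay_ode A B tau x u ->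
    0 <= s -> s <= t -> t <= s + L -> 0 <= U ->
    (forall w, s < w < t -> `|u (w - tau)| <= U) ->
    `|x t| <= C * (`|x s| + U).
Proof.
move=> L0.
have [Ce Ce0 eC] := mx_continuous_itv_bounded (- L) L (@expmN_continuous R n A).
pose c := n%:R * Ce * (1 + m%:R * (n%:R * Ce * `|B|) * L).
have c0 : 0 <= c.
  by rewrite !mulr_ge0// addr_ge0// !mulr_ge0.
exists c => // x u s t U ode s0 st tL U0 uU.
pose b := t - s.
have b0 : 0 <= b by rewrite subr_ge0.
have bL : b <= L by rewrite lerBlDl.
have sb : s + b = t by rewrite /b addrC subrK.
pose F z := expm (- z *: A) *m B *m u (s - tau + z).
have FU : `|mint 0 b F| <= m%:R * (n%:R * Ce * `|B|) * U * b.
  rewrite -[X in _ * X]subr0; apply: mxnorm_mint_le => //.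
    by rewrite !mulr_ge0.
  move=> z /andP[z0 zb]; apply: mxnormM_le.
    by apply: mxnormM_le => //; apply: eC; lra.
  rewrite (_ : s - tau + z = s + z - tau); last by rewrite addrAC.
  by apply: uU; rewrite ltrDl z0 -sb ltrD2l.
have := @duhamel R n m A B tau x u F s 0 b U ode.
rewrite addr0 sb oppr0 expm0 mul1mx => /(_ s0 b0 U0 uU (fun _ _ => erefl)) E.
have xE : x t = expm (- - b *: A) *m (x s + mint 0 b F).
  by rewrite E [x s + _]addrC subrK mulmxA opprK expmKN mul1mx.
rewrite xE (le_trans (mxnormM_le (eC (- b) _) (lexx _)))//; first lra.
rewrite /c -[leRHS]mulrA ler_wpM2l ?mulr_ge0//.
apply: (le_trans (ler_normD _ _)).
rewrite mulrDl mul1r -addrA lerD2l (le_trans FU)//.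
set k := m%:R * _.
have k0 : 0 <= k by rewrite !mulr_ge0.
rewrite (_ : k * U * b = k * b * U); last by ring.
apply: (@le_trans _ _ (k * L * U)).
  by rewrite ler_wpM2r// ler_wpM2l.
rewrite -[leLHS]add0r lerD// ler_wpM2l ?mulr_ge0//.
by rewrite -[leLHS]add0r lerD2r.
Qed.
End state_growth.

Section closed_loop.
Context {R : realType} {n m : nat} (A : 'M[R]_n) (B : 'M[R]_(n, m))
  (K : 'M[R]_(m, n)) (T r tau rt : R) (l q : nat).
Context (T_gt0 : 0 < T) (r_ge0 : 0 <= r) (tauE : tau = l%:R * T)
    (qE : q = Num.truncn (r / T)) (rtE : rt = r - q%:R * T).

Let mulST k : k.+1%:R * T = k%:R * T + T.
Proof. by rewrite -natr1 mulrDl mul1r. Qed.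

Let rtauE : r + tau = (l + q)%:R * T + rt.
Proof. by rewrite rtE tauE natrD; ring. Qed.

Let rT : q%:R * T <= r < q.+1%:R * T.
Proof.
have := @truncn_itv R (r / T); rewrite divr_ge0 ?(ltW T_gt0)// -qE => /(_ isT).
by rewrite ler_pdivlMr// ltr_pdivrMr.
Qed.

Let rt_ge0 : 0 <= rt.
Proof. by rewrite rtE subr_ge0; case/andP: rT. Qed.

Let rt_ltT : rt < T.
Proof. by rewrite rtE ltrBlDl -mulST; case/andP: rT. Qed.

(** The window [-(r + tau), 0] is divided at the points - cut p: the first l + q
    pieces have length T and the last one has length rt. *)
Let cut (p : nat) := Num.min (p%:R * T) (r + tau).

Let cutE p : (p <= l + q)%N -> cut p = p%:R * T.
Proof.
move=> plq; apply/min_idPl; rewrite rtauE (@le_trans _ _ ((l + q)%:R * T))//.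
  by rewrite ler_pM2r// ler_nat.
by rewrite lerDl.
Qed.

Let cut_last : cut (l + q).+1 = r + tau.
Proof. by apply/min_idPr; rewrite rtauE mulST lerD2l ltW. Qed.

Let cut_ge p : (0 < p <= l + q + 1)%N -> p.-1%:R * T <= cut p.
Proof.
move=> /andP[p0 plq]; have pE : p%:R * T = p.-1%:R * T + T by rewrite -mulST prednK.
rewrite le_min pE lerDl (ltW T_gt0)/= rtauE.
rewrite (@le_trans _ _ ((l + q)%:R * T)) ?lerDl// ler_pM2r// ler_nat.
by rewrite -ltnS prednK// -addn1.
Qed.

(** Both sides are increments of primitives of exp(-As): a translate of one
    primitive, multiplied by a constant exponential, is another. *)
Lemma Qmx_mint p : (0 < p <= l + q + 1)%N ->
  Qmx A T rt l q p = mint (- cut p) (- (p.-1%:R * T)) (fun s => expm (- s *: A)).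
Proof.
move=> /andP[p0 plq]; have [P dP] := expm_primitive A.
have dPN (c s : R) : mx_derive (fun s => - P (- (s + c))) s (expm (- (s + c) *: A)).
  rewrite -[expm _]opprK -[- expm _]scaleN1r; apply: mx_deriveN.
  apply: (mx_derive_comp (g := fun s => - (s + c))); first exact: dP.
  exact: (is_deriveN (is_derive_shift s 1 c)).
have dG (k c s : R) : k = c -> mx_derive (fun s => expm (k *: A) *m - P (- (s + c))) s
    (expm (- s *: A)).
  move=> ->; have := mx_deriveM (mx_derive_cst (expm (c *: A)) s) (dPN c s).
  by rewrite mul0mx add0r -expmD opprD subrK.
have cE i j := @expmN_continuous R n A i j.
rewrite /Qmx; case: ifPn => [pl|].
  have pE : p%:R * T = p.-1%:R * T + T by rewrite -mulST prednK.
  rewrite cutE//.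
  rewrite (mint_continuous (ltW T_gt0) (G := fun s => - P (- (s + 0))))//; last first.
    by move=> s; have := dPN 0 s; rewrite addr0.
  rewrite (mint_continuous _ (fun s => dG (p%:R * T) _ s erefl))//; last first.
    by rewrite lerN2 pE lerDl ltW.
  rewrite -mulmxBr; congr (_ *m (- P _ - - P _)); first by rewrite pE; ring.
  by rewrite addNr add0r.
rewrite -ltnNge => pl; have {pl plq} -> : p = (l + q).+1.
  by apply/eqP; rewrite eqn_leq pl andbT -addn1.
rewrite cut_last /= rtauE.
rewrite (mint_continuous rt_ge0 dP); last first.
  by move=> i j s; exact: is_derive_continuous (expm_derive A s i j).
rewrite (mint_continuous _ (fun s => dG ((l + q)%:R * T) _ s erefl))//; last first.
  by rewrite lerN2 lerDl.
rewrite -mulmxBr; congr (_ *m _); rewrite opprK addrC; congr (- P _ + P _); ring.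
Qed.

Lemma mint_expm_mulmx k (a b : R) (M : 'M[R]_(n, k)) : a <= b ->
  mint a b (fun s => expm (- s *: A) *m M) = mint a b (fun s => expm (- s *: A)) *m M.
Proof.
move=> ab; have [P dP] := expm_primitive A.
have dN (s : R) : mx_derive (fun s => - P (- s)) s (expm (- s *: A)).
  rewrite -[expm _]opprK -[- expm _]scaleN1r; apply: mx_deriveN.
  by apply: (mx_derive_comp (g := -%R)); exact: dP.
have dNM (s : R) : mx_derive (fun s => - P (- s) *m M) s (expm (- s *: A) *m M).
  have := mx_deriveM (dN s) (mx_derive_cst M s).
  by rewrite mulmx0 addr0.
rewrite (mint_continuous ab dN); last exact: expmN_continuous.
rewrite (mint_continuous ab dNM); first by rewrite mulmxBl.
move=> i j s; apply: is_derive_continuous.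
exact: (mx_deriveM (expmN_derive A s) (mx_derive_cst M s)).
Qed.

(** The solutions with initial data bounded by D, detached from the functions x0
    and u0, of which only the size matters for the estimates. *)
Definition bounded_loop (D : R) (x : R -> 'cV[R]_n) (u : R -> 'cV[R]_m)
    (v : nat -> 'cV[R]_m) :=
  [/\ delay_ode A B tau x u,
      (forall t : R, - r <= t <= 0 -> `|x t| <= D),
      (forall t : R, - (r + tau) <= t < 0 -> `|u t| <= D),
      (forall i (t : R), i%:R * T <= t < i.+1%:R * T -> u t = v i) &
      forall i, v i = control_law A B K T r tau rt l q x u v i].

Section trajectory.
Context {D : R} {x : R -> 'cV[R]_n} {u : R -> 'cV[R]_m} {v : nat -> 'cV[R]_m}.
Context (xuv : bounded_loop D x u v).

Let uv i (t : R) : i%:R * T <= t < i.+1%:R * T -> u t = v i.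
Proof. by case: xuv => _ _ _ h _; exact: h. Qed.

Let ode : delay_ode A B tau x u. Proof. by case: xuv. Qed.

Let tau_ge0 : 0 <= tau.
Proof. by rewrite tauE mulr_ge0// ltW. Qed.

Let iT_ge0 i : 0 <= i%:R * T.
Proof. by rewrite mulr_ge0// ltW. Qed.

Lemma input_bounded j : exists2 U : R, 0 <= U &
  forall t : R, - (r + tau) <= t < j%:R * T -> `|u t| <= U.
Proof.
elim: j => [|j [U U0 uU]].
  exists `|D| => // t; rewrite mul0r => /andP[rt0 t0].
  case: xuv => _ _ uD _ _; apply: le_trans (ler_norm D).
  by apply: uD; rewrite rt0.
exists (U + `|v j|) => [|t /andP[rtt tj]]; first exact: addr_ge0.
have [tj'|tj'] := ltP t (j%:R * T).
  by rewrite (le_trans (uU t _)) ?rtt// lerDl.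
by rewrite (@uv j) ?tj'// lerDr.
Qed.

(** The state at time iT + tau + s transported back to time iT + tau by the free
    flow; its increments are the contributions of the input. *)
Let pullback (i : nat) (s : R) := expm (- s *: A) *m x (i%:R * T + tau + s).

Lemma pullback_increment (F : R -> 'cV[R]_n) i (a b : R) :
  0 <= i%:R * T + tau + a -> a <= b ->
  (forall s, a < s < b -> F s = expm (- s *: A) *m B *m u (i%:R * T + s)) ->
  mint a b F = pullback i b - pullback i a.
Proof.
move=> ia ab FE.
pose N := (Num.truncn ((i%:R * T + b) / T)).+1.
have bN : i%:R * T + b < N%:R * T.
  have [b0|b0] := leP 0 (i%:R * T + b); last by rewrite (lt_le_trans b0).
  have := @truncn_itv R ((i%:R * T + b) / T).
  by rewrite divr_ge0 ?(ltW T_gt0)// => /(_ isT) /andP[_]; rewrite ltr_pdivrMr.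
have [U U0 uU] := input_bounded N.
apply: (@duhamel R n m A B tau x u F (i%:R * T + tau) a b U ode ia ab U0).
- move=> w /andP[aw wb]; apply: uU; have w0 : 0 < w := le_lt_trans ia aw.
  rewrite opprD lerD2r (@le_trans _ _ 0) ?oppr_le0 ?(ltW w0)//= ltrBlDr (lt_trans wb)//.
  by rewrite [ltLHS]addrAC ltrD2r.
- by move=> s sab; rewrite FE// addrK.
Qed.

(** For i > q the p-th piece of the window has x governed by the equation, so
    [duhamel] applies on it.  If p <= i the input there is the constant v_(i - p)
    and the integral is Q_p B v_(i - p); otherwise the term is an integral by
    definition. *)
Lemma input_term_increment i p : (q < i)%N -> (0 < p <= l + q + 1)%N ->
  input_term A B T r tau rt l q u v i p =
  pullback i (- (p.-1%:R * T)) - pullback i (- cut p).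
Proof.
move=> qi pb; have /andP[p0 plq] := pb.
have pE : p%:R * T = p.-1%:R * T + T by rewrite -mulST prednK.
have cut_bound := cut_ge pb.
have iq : q.+1%:R * T <= i%:R * T by rewrite ler_pM2r// ler_nat.
have rq : r < q.+1%:R * T by case/andP: rT.
have cutr : cut p <= r + tau by rewrite ge_min lexx orbT.
have cutp : cut p <= p%:R * T by rewrite ge_min lexx.
have ia0 : 0 <= i%:R * T + tau - cut p by lra.
rewrite /input_term; case: ifPn => [pi|].
  rewrite Qmx_mint// -mulmxA -mint_expm_mulmx ?lerN2//.
  apply: pullback_increment; rewrite ?lerN2//.
  move=> s /andP[cs sp]; rewrite -mulmxA (@uv (i - p)%N)//.
  have -> : (i - p).+1%:R * T = i%:R * T - p.-1%:R * T.
    rewrite -subSn// -[X in (_ - X)%N](prednK p0) subSS natrB ?mulrBl//.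
    exact: leq_trans (leq_pred p) pi.
  rewrite natrB// mulrBl lerD2l ltrD2l sp andbT.
  by rewrite (le_trans _ (ltW cs))// lerN2.
rewrite -ltnNge => ip; apply: pullback_increment; rewrite ?lerN2//.
Qed.

(** The sum over p telescopes to the increment of the pullback over the whole
    window, and its value at the left end cancels the term in x(iT - r). *)
Lemma control_predicts i : (q < i)%N -> v i = K *m x (i%:R * T + tau).
Proof.
move=> qi; case: (xuv) => _ _ _ _ ->.
rewrite /control_law -mulmxA -mulmxDr; congr (_ *m _).
rewrite (eq_big_nat _ _
  (F2 := fun p => pullback i (- (p.-1%:R * T)) - pullback i (- cut p))); last first.
  by move=> p /andP[p0 plq]; apply: input_term_increment => //; rewrite p0.
rewrite big_add1/= addn1.
rewrite (eq_big_nat _ _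
  (F2 := fun p => - pullback i (- cut p.+1) - - pullback i (- cut p))); last first.
  by move=> p /andP[_ plq]; rewrite opprK [RHS]addrC -(cutE (p := p)).
rewrite telescope_sumr// cut_last cutE// mul0r !opprK oppr0 {1}/pullback.
rewrite [_ + tau + - _](_ : _ = i%:R * T - r); last by ring.
by rewrite opprK addrA subrr add0r /pullback oppr0 expm0 mul1mx addr0.
Qed.

(** Between iT + tau and (i+1)T + tau the delayed input equals v_i, which is
    K x(iT + tau) by [control_predicts]. *)
Lemma predictor_step i : (q < i)%N ->
  x (i.+1%:R * T + tau) =
  expm (T *: A) *m (1%:M + mint 0 T (fun w => expm (- w *: A)) *m B *m K)
    *m x (i%:R * T + tau).
Proof.
move=> qi; have it0 : 0 <= i%:R * T + tau + 0 by rewrite addr0 addr_ge0.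
have := @pullback_increment (fun s => expm (- s *: A) *m (B *m v i)) i 0 T it0 (ltW T_gt0).
rewrite mint_expm_mulmx ?(ltW T_gt0)// => E.
have {}E : mint 0 T (fun s => expm (- s *: A)) *m (B *m v i) = pullback i T - pullback i 0.
  apply: E => s /andP[s0 sT]; rewrite mulmxA (@uv i)// mulST.
  by rewrite lerDl (ltW s0) ltrD2l.
rewrite /pullback oppr0 expm0 mul1mx addr0 in E.
have {}E : expm (- T *: A) *m x (i.+1%:R * T + tau) =
    x (i%:R * T + tau) + mint 0 T (fun s => expm (- s *: A)) *m (B *m v i).
  by rewrite E [RHS]addrC subrK mulST [_ + T + tau]addrAC.
transitivity (expm (T *: A) *m (expm (- T *: A) *m x (i.+1%:R * T + tau))).
  by rewrite mulmxA expmKN mul1mx.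
rewrite E control_predicts// -[RHS]mulmxA; congr (_ *m _).
by rewrite mulmxDl mul1mx !mulmxA.
Qed.

End trajectory.
Let rtau_ge0 : 0 <= r + tau.
Proof. by rewrite addr_ge0// tauE mulr_ge0// ltW. Qed.

Let tau_ge0 : 0 <= tau.
Proof. by rewrite tauE mulr_ge0// ltW. Qed.

Let bounded_loop_ge0 D x u v : bounded_loop D x u v -> 0 <= D.
Proof.
move=> [_ xD _ _ _]; apply: (le_trans (normr_ge0 (x 0))).
by apply: xD; rewrite lexx oppr_le0 r_ge0.
Qed.

Lemma input_term_bound : exists2 c : R, 0 <= c & forall D x u v i p (S : R),
  bounded_loop D x u v -> 0 <= S ->
  (forall t : R, - (r + tau) <= t < i%:R * T -> `|u t| <= S) ->
  (0 < p <= l + q + 1)%N ->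
  `|input_term A B T r tau rt l q u v i p| <= c * S.
Proof.
have [Ce Ce0 eC] := mx_continuous_itv_bounded (- (r + tau)) 0 (@expmN_continuous R n A).
pose CQ := \sum_(p < (l + q).+2) `|Qmx A T rt l q p|.
have CQ0 : 0 <= CQ by exact: sumr_ge0.
pose c := m%:R * (n%:R * Ce * `|B|) * (r + tau) + m%:R * (n%:R * CQ * `|B|).
have c1 : 0 <= m%:R * (n%:R * Ce * `|B|) * (r + tau) by rewrite !mulr_ge0.
have c2 : 0 <= m%:R * (n%:R * CQ * `|B|) by rewrite !mulr_ge0.
exists c => [|D x u v i p S xuv S0 uS pb]; first exact: addr_ge0.
have /andP[p0 plq] := pb.
rewrite /input_term; case: ifPn => [pi|_].
  apply: (@le_trans _ _ (m%:R * (n%:R * CQ * `|B|) * S)); last first.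
    by rewrite ler_wpM2r// lerDr.
  apply: mxnormM_le.
    apply: mxnormM_le => //; rewrite addn1 -ltnS in plq.
    by rewrite /CQ (bigD1 (Ordinal plq))//= lerDl sumr_ge0.
  case: (xuv) => _ _ _ uv _.
  rewrite -(uv (i - p)%N ((i - p)%:R * T)) ?lexx ?ltr_pM2r ?ltr_nat//=.
  apply: uS; rewrite ltr_pM2r// ltr_nat; apply/andP; split.
    by rewrite (@le_trans _ _ 0) ?oppr_le0// mulr_ge0// ltW.
  by rewrite ltn_subrL p0 (leq_trans p0 pi).
apply: (@le_trans _ _ (m%:R * (n%:R * Ce * `|B|) * (r + tau) * S)); last first.
  by rewrite ler_wpM2r// lerDl.
have cutr : cut p <= r + tau by rewrite ge_min lexx orbT.
have p1T : 0 <= p.-1%:R * T by rewrite mulr_ge0// ltW.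
apply: le_trans (mxnorm_mint_le (C := m%:R * (n%:R * Ce * `|B|) * S) _ _ _) _.
- by rewrite lerN2; exact: cut_ge.
- by rewrite !mulr_ge0.
- move=> s /andP[cs sp].
  have s0 : s < 0 by rewrite (lt_le_trans sp)// oppr_le0.
  have rs : - (r + tau) <= s by rewrite (le_trans _ (ltW cs))// lerN2.
  apply: mxnormM_le.
    by apply: mxnormM_le => //; apply: eC; rewrite rs ltW.
  apply: uS; rewrite gtrDl s0 andbT (le_trans rs)// lerDr.
  by rewrite mulr_ge0// ltW.
- rewrite [leRHS]mulrAC ler_wpM2l ?mulr_ge0//.
  by rewrite opprK addrC (le_trans _ cutr)// gerDl oppr_le0.
Qed.

Lemma control_bound : exists2 c : R, 0 <= c & forall D x u v i (S : R),
  bounded_loop D x u v -> 0 <= S -> `|x (i%:R * T - r)| <= S ->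
  (forall t : R, - (r + tau) <= t < i%:R * T -> `|u t| <= S) ->
  `|v i| <= c * S.
Proof.
have [c1 c10 c1P] := input_term_bound.
pose k := `|K *m expm ((r + tau) *: A)|.
have k0 : 0 <= k by exact: normr_ge0.
pose c := n%:R * k + n%:R * `|K| * ((l + q + 1)%:R * c1).
exists c => [|D x u v i S xuv S0 xS uS]; first by rewrite addr_ge0// !mulr_ge0.
case: (xuv) => _ _ _ _ ->; rewrite /control_law mulrDl.
apply: (le_trans (ler_normD _ _)); apply: lerD; first exact: mxnormM_le.
rewrite -[leRHS]mulrA; apply: mxnormM_le => //.
apply: (le_trans (ler_norm_sum _ _ _)).
apply: (@le_trans _ _ (\sum_(1 <= p < (l + q + 1).+1) c1 * S)).
  by rewrite !big_nat; apply: ler_sum => p pb; apply: (c1P D x u v).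
by rewrite sumr_const_nat subn1 -[leLHS]mulr_natl mulrA.
Qed.

(** For i <= q the measured state lies in the initial history and is bounded by D,
    so each new input value multiplies the bound by at most 1 + c. *)
Lemma input_bound_init : exists2 c : R, 0 <= c & forall D x u v,
  bounded_loop D x u v -> forall t : R, - (r + tau) <= t < q.+1%:R * T -> `|u t| <= c * D.
Proof.
have [c c0 cP] := control_bound.
exists ((1 + c) ^+ q.+1) => [|D x u v xuv]; first by rewrite exprn_ge0// addr_ge0.
have D0 := bounded_loop_ge0 xuv; have [_ xD uD uv _] := xuv.
have c1 : 1 <= 1 + c by rewrite lerDl.
suff H i : (i <= q.+1)%N -> forall t : R, - (r + tau) <= t < i%:R * T ->
  `|u t| <= (1 + c) ^+ i * D by exact: H.
elim: i => [|i IH] iq t.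
  by rewrite mul0r mul1r => /uD.
have {}IH := IH (ltnW iq).
have S0 : 0 <= (1 + c) ^+ i * D by rewrite mulr_ge0// exprn_ge0// addr_ge0.
move=> /andP[rt0 ti]; rewrite exprS -mulrA mulrDl mul1r.
have [tj|tj] := ltP t (i%:R * T).
  by rewrite (le_trans (IH t _)) ?rt0// lerDl mulr_ge0.
rewrite (uv i) ?tj//.
apply: (@le_trans _ _ (c * ((1 + c) ^+ i * D))); last by rewrite lerDr.
apply: (cP D x u v) => //.
apply: (@le_trans _ _ D); last by rewrite ler_peMl// exprn_ege1.
have /andP[qr _] := rT; have iT : i%:R * T <= q%:R * T by rewrite ler_pM2r// ler_nat.
apply: xD; rewrite lerDr subr_le0 (le_trans iT qr) andbT.
by rewrite mulr_ge0// ltW.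
Qed.

(** [state_growth] from time 0, with the input bound of [input_bound_init]. *)
Lemma state_bound_init : exists2 c : R, 0 <= c & forall D x u v,
  bounded_loop D x u v -> forall t : R, - r <= t <= q.+1%:R * T + tau -> `|x t| <= c * D.
Proof.
have [c c0 cP] := input_bound_init.
have H0 : 0 <= q.+1%:R * T + tau by rewrite addr_ge0// mulr_ge0// ltW.
have [g g0 gP] := state_growth A B tau H0.
exists (1 + g * (1 + c)) => [|D x u v xuv t /andP[rt0 tH]].
  by rewrite addr_ge0// mulr_ge0// addr_ge0.
have D0 := bounded_loop_ge0 xuv; have [ode xD uD uv _] := xuv.
have gc : 0 <= g * (1 + c) by rewrite mulr_ge0// addr_ge0.
have [t0|t0] := leP t 0.
  by rewrite (le_trans (xD t _)) ?rt0// ler_peMl// lerDl.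
apply: (@le_trans _ _ (g * (`|x 0| + c * D))).
  apply: (gP x u) => //; [exact: ltW|by rewrite add0r|exact: mulr_ge0|].
  move=> w /andP[w0 wt]; apply: (cP D x u v xuv); rewrite ltrBlDr (lt_le_trans wt)// andbT.
  by rewrite opprD lerD2r (@le_trans _ _ 0) ?oppr_le0// ltW.
have x0D : `|x 0| <= D by apply: xD; rewrite lexx oppr_le0 r_ge0.
rewrite mulrDl mul1r -mulrA [(1 + c) * D]mulrDl mul1r.
by rewrite -[leLHS]add0r lerD// ler_wpM2l// lerD2r.
Qed.

Let F := expm (T *: A) *m (1%:M + mint 0 T (fun w => expm (- w *: A)) *m B *m K).

Context (schur : forall z : R[i],
  eigenvalue (map_mx (real_complex R) F) z -> `|z| < 1).

Lemma sampled_state_decay : exists C rho : R, [/\ 0 <= C, 0 < rho, rho < 1 &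
  forall D x u v k, bounded_loop D x u v ->
    `|x ((q.+1 + k)%:R * T + tau)| <= C * rho ^+ k * D].
Proof.
have [C [rho [C0 rho0 rho1 FC]]] := schur_powers schur.
have [c c0 cP] := state_bound_init.
exists (n%:R * C * c), rho; split => //; first by rewrite !mulr_ge0.
move=> D x u v k xuv; have D0 := bounded_loop_ge0 xuv.
have -> : x ((q.+1 + k)%:R * T + tau) = F ^+ k *m x (q.+1%:R * T + tau).
  elim: k => [|k IH]; first by rewrite addn0 expr0 mul1mx.
  rewrite addnS (predictor_step xuv) ?ltnS ?leq_addr// IH exprS.
  by rewrite [F * _]/(F *m _) mulmxA.
have xq : `|x (q.+1%:R * T + tau)| <= c * D.
  apply: (cP D x u v xuv); rewrite lexx andbT.
  by rewrite (@le_trans _ _ 0) ?oppr_le0// addr_ge0// mulr_ge0// ltW.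
have Fk : `|F ^+ k| <= C * rho ^+ k.
  by apply: mxnorm_le; [rewrite mulr_ge0// exprn_ge0// ltW|exact: FC].
apply: (le_trans (mxnormM_le Fk xq)).
by rewrite le_eqVlt; apply/orP; left; apply/eqP; ring.
Qed.

(** Geometric decay of the samples becomes exponential decay in continuous time
    with sigma = - ln rho / T.  The shift H covers the initial stretch, on which
    the exponential is at least 1, together with one sampling period. *)
Lemma trajectory_decay : exists c sigma H : R, [/\ 0 <= c, 0 < sigma &
  forall D x u v, bounded_loop D x u v ->
    (forall t : R, - r <= t -> `|x t| <= c * D * expR (sigma * (H - t))) /\
    (forall t : R, - (r + tau) <= t -> `|u t| <= c * D * expR (sigma * (H - t)))].
Proof.
have [C [rho [C0 rho0 rho1 xC]]] := sampled_state_decay.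
have [cx cx0 cxP] := state_bound_init.
have [cu cu0 cuP] := input_bound_init.
have [g g0 gP] := state_growth A B tau (ltW T_gt0).
pose k := n%:R * `|K|.
have k0 : 0 <= k by exact: mulr_ge0.
pose sigma := - ln rho / T.
pose H := q.+2%:R * T + tau.
have sigma0 : 0 < sigma.
  by rewrite divr_gt0// oppr_gt0 ln_lt0// rho0.
have rhoE j : rho ^+ j = expR (- sigma * (j%:R * T)).
  have -> : - sigma * (j%:R * T) = j%:R * ln rho.
    by rewrite /sigma; field; rewrite gt_eqF.
  by rewrite expRM_natl lnK// posrE.
have rate j t : t <= (q.+1 + j).+1%:R * T + tau -> rho ^+ j <= expR (sigma * (H - t)).
  move=> tj; rewrite rhoE ler_expR mulNr -mulrN ler_wpM2l ?(ltW sigma0)//.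
  move: tj; rewrite -addSn natrD mulrDl /H; lra.
have early t : t <= q.+1%:R * T + tau -> 1 <= expR (sigma * (H - t)).
  move=> tq; rewrite -(expr0 rho); apply: rate; rewrite addn0 (le_trans tq)//.
  by rewrite lerD2r ler_pM2r// ler_nat.
have sampled (t : R) : q.+1%:R * T <= t -> exists j,
    (q.+1 + j)%:R * T <= t < (q.+1 + j).+1%:R * T.
  move=> qt; have t0 : 0 <= t by rewrite (le_trans _ qt)// mulr_ge0// ltW.
  have := @truncn_itv R (t / T); rewrite divr_ge0 ?(ltW T_gt0)// => /(_ isT).
  rewrite ler_pdivlMr// ltr_pdivrMr// => tN.
  exists (Num.truncn (t / T) - q.+1)%N; rewrite subnKC//.
  have /andP[_ tN1] := tN.
  by have := le_lt_trans qt tN1; rewrite ltr_pM2r// ltr_nat ltnS.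
pose c := cx + cu + (g * (1 + k) * C) + k * C.
have c10 : 0 <= g * (1 + k) * C by rewrite !mulr_ge0// addr_ge0.
have c20 : 0 <= k * C by rewrite mulr_ge0.
have [cxc cuc c1c c2c] : [/\ cx <= c, cu <= c, g * (1 + k) * C <= c & k * C <= c].
  by rewrite /c; split; lra.
have c0 : 0 <= c by exact: le_trans cxc.
exists c, sigma, H; split => // D x u v xuv.
have D0 := bounded_loop_ge0 xuv; have [ode _ _ uv _] := xuv.
have vC j : `|v (q.+1 + j)%N| <= k * (C * rho ^+ j * D).
  rewrite (control_predicts xuv) ?ltnS ?leq_addr//.
  by apply: mxnormM_le => //; exact: (xC D x u v).
have rhoj j : 0 <= C * rho ^+ j * D by rewrite !mulr_ge0// exprn_ge0// ltW.
have combine (a e f : R) : 0 <= a -> a <= c -> 0 <= e -> e <= f -> a * D * e <= c * D * f.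
  move=> a0 ac e0 ef; apply: ler_pM => //; first exact: mulr_ge0.
  by rewrite ler_wpM2r.
split=> t tlo.
- have [tq|qt] := leP t (q.+1%:R * T + tau).
    apply: (le_trans (cxP D x u v xuv t _)); first by rewrite tlo.
    by rewrite -[leLHS]mulr1; apply: combine => //; exact: early.
  have [|j /andP[jt tj]] := sampled (t - tau); first by rewrite lerBrDr ltW.
  rewrite lerBrDr in jt; rewrite ltrBlDr in tj.
  apply: (@le_trans _ _ (g * (1 + k) * C * D * rho ^+ j)); last first.
    by apply: combine => //; [rewrite exprn_ge0// ltW|apply: rate; exact: ltW].
  apply: (@le_trans _ _ (g * (C * rho ^+ j * D + k * (C * rho ^+ j * D)))); last first.
    by rewrite le_eqVlt; apply/orP; left; apply/eqP; ring.
  apply: (@le_trans _ _ (g * (`|x ((q.+1 + j)%:R * T + tau)| + k * (C * rho ^+ j * D)))).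
    apply: (gP x u) => //.
    + by rewrite addr_ge0// mulr_ge0// ltW.
    + by rewrite addrAC -mulST ltW.
    + exact: mulr_ge0.
    + move=> w /andP[jw wt]; rewrite (uv (q.+1 + j)%N)//.
      by rewrite lerBrDr (ltW jw) ltrBlDr (lt_trans wt).
  by rewrite ler_wpM2l// lerD2r; exact: (xC D x u v).
- have [tq|qt] := ltP t (q.+1%:R * T).
    apply: (le_trans (cuP D x u v xuv t _)); first by rewrite tlo.
    rewrite -[leLHS]mulr1; apply: combine => //; apply: early.
    by rewrite (le_trans (ltW tq))// lerDl.
  have [j tj] := sampled t qt; rewrite (uv _ _ tj) (le_trans (vC j))//.
  have /andP[_ tj1] := tj.
  rewrite (_ : k * (C * rho ^+ j * D) = k * C * D * rho ^+ j); last by ring.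
  apply: combine => //; first by rewrite exprn_ge0// ltW.
  by apply: rate; rewrite (le_trans (ltW tj1))// lerDl.
Qed.

End closed_loop.

(** * Exponential stability *)

Section supnorms.
Context {R : realType}.

Lemma continuous_enorm_bounded n (r : R) (x0 : R -> 'cV[R]_n) : 0 <= r ->
  {within `[- r, 0], continuous x0} ->
  exists C, forall t, - r <= t <= 0 -> enorm (x0 t) <= C.
Proof.
move=> r0 cx.
have [||c _ cP] := @EVT_max _ (fun t => `|x0 t|) (- r) 0.
- by rewrite oppr_le0.
- by move=> t; apply: (@continuous_comp _ _ _ (x0 : subspace _ -> _) _ t (cx t));
    exact: norm_continuous.
exists (n%:R * `|x0 c|) => t tr; apply: (le_trans (enorm_le_mxnorm _)).
by rewrite ler_wpM2l// cP// in_itv.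
Qed.

(** A supremum in the reals is genuine only for a bounded set, hence the bound C. *)
Lemma supnorm_closed_ge n (r C : R) (f : R -> 'cV[R]_n) t :
  (forall t, - r <= t <= 0 -> enorm (f t) <= C) -> - r <= t <= 0 ->
  enorm (f t) <= supnorm_closed r f.
Proof.
move=> fC tr; apply: ub_le_sup; last by exists t => //=; rewrite in_itv.
by exists C => _ [s /= + <-]; rewrite in_itv => /fC.
Qed.

Lemma supnorm_open_ge n (r C : R) (f : R -> 'cV[R]_n) t :
  (forall t, - r <= t < 0 -> enorm (f t) <= C) -> - r <= t < 0 ->
  enorm (f t) <= supnorm_open r f.
Proof.
move=> fC tr; apply: ub_le_sup; last by exists t => //=; rewrite in_itv.
by exists C => _ [s /= + <-]; rewrite in_itv => /fC.
Qed.

Lemma supnorm_closed_le n (r C : R) (f : R -> 'cV[R]_n) : 0 <= r ->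
  (forall t, - r <= t <= 0 -> enorm (f t) <= C) -> supnorm_closed r f <= C.
Proof.
move=> r0 fC; apply: ge_sup => [|_ [s /= + <-]]; last by rewrite in_itv => /fC.
by exists (enorm (f 0)), 0 => //=; rewrite in_itv/= oppr_le0 r0 lexx.
Qed.

Lemma supnorm_open_le n (r C : R) (f : R -> 'cV[R]_n) : 0 < r ->
  (forall t, - r <= t < 0 -> enorm (f t) <= C) -> supnorm_open r f <= C.
Proof.
move=> r0 fC; apply: ge_sup => [|_ [s /= + <-]]; last by rewrite in_itv => /fC.
by exists (enorm (f (- r))), (- r) => //=; rewrite in_itv/= lexx oppr_lt0.
Qed.

End supnorms.

Unset Implicit Arguments.

Theorem corollary3p4 (R : realType) (n m : nat) (A : 'M[R]_n)
    (B : 'M[R]_(n, m)) (K : 'M[R]_(m, n)) (T r tau rt : R) (l q : nat)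
    (T_gt0 : 0 < T) (r_ge0 : 0 <= r) (tau_ge0 : 0 <= tau)
    (rtau_gt0 : 0 < r + tau) (tauE : tau = l%:R * T)
    (qE : q = Num.truncn (r / T)) (rtE : rt = r - q%:R * T)
    (schur : forall z : R[i],
       eigenvalue
         (map_mx (real_complex R)
            (expm (T *: A) *m
               (1%:M + mint 0 T (fun w => expm (- w *: A)) *m B *m K))) z ->
       `|z| < 1) :
  exists M sigma : R, [/\ 0 < M, 0 < sigma &
    forall (x0 : R -> 'cV[R]_n) (u0 : R -> 'cV[R]_m),
      {within `[- r, 0], continuous x0} ->
      measurable_bounded `[- (r + tau), 0[ u0 ->
      forall (x : R -> 'cV[R]_n) (u : R -> 'cV[R]_m),
        closed_loop_solution A B K T r tau rt l q x0 u0 x u ->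
        forall t : R, 0 <= t ->
          supnorm_closed r (history t x)
            + supnorm_open (r + tau) (history t u)
          <= M * (supnorm_closed r x0 + supnorm_open (r + tau) u0)
               * expR (- sigma * t)].
Proof.
have [c [sigma [H [c0 sigma0 decay]]]] :=
  trajectory_decay T_gt0 r_ge0 tauE qE rtE schur.
set k1 := n%:R * c * expR (sigma * (H + r)).
set k2 := m%:R * c * expR (sigma * (H + (r + tau))).
have k10 : 0 <= k1 by rewrite !mulr_ge0// expR_ge0.
have k20 : 0 <= k2 by rewrite !mulr_ge0// expR_ge0.
exists (k1 + k2 + 1), sigma; split => //; first by rewrite ltr_wpDl// addr_ge0.
move=> x0 u0 cx0 [_ [Cu u0C]] x u [xx0 uu0 ode [v [uv vE]]] t t0.
have [Cx x0C] := continuous_enorm_bounded r_ge0 cx0.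
have {}u0C s : - (r + tau) <= s < 0 -> enorm (u0 s) <= Cu.
  by move=> sr; apply: u0C; rewrite /= in_itv.
set Dx := supnorm_closed r x0; set Du := supnorm_open (r + tau) u0.
have Dx0 : 0 <= Dx.
  apply: (le_trans (sqrtr_ge0 _ : 0 <= enorm (x0 0))).
  by apply: (supnorm_closed_ge x0C); rewrite lexx oppr_le0 r_ge0.
have Du0 : 0 <= Du.
  apply: (le_trans (sqrtr_ge0 _ : 0 <= enorm (u0 (- (r + tau))))).
  by apply: (supnorm_open_ge u0C); rewrite lexx oppr_lt0.
have lp : bounded_loop A B K T r tau rt l q (Dx + Du) x u v.
  split => //.
  - move=> s sr; have := xx0 s; rewrite in_itv /history add0r => /(_ sr) ->.
    apply: (le_trans (mxnorm_le_enorm _)).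
    by apply: (le_trans (supnorm_closed_ge x0C sr)); rewrite lerDl.
  - move=> s sr; have := uu0 s; rewrite in_itv /history add0r => /(_ sr) ->.
    apply: (le_trans (mxnorm_le_enorm _)).
    by apply: (le_trans (supnorm_open_ge u0C sr)); rewrite lerDr.
have [xdecay udecay] := decay _ _ _ _ lp.
have D0 : 0 <= Dx + Du by exact: addr_ge0.
have shift (d h s : R) : 0 <= d -> - h <= s ->
    d * (c * (Dx + Du) * expR (sigma * (H - (t + s)))) <=
    d * c * expR (sigma * (H + h)) * (Dx + Du) * expR (- sigma * t).
  move=> d0 hs; rewrite -!mulrA ler_wpM2l// ler_wpM2l//.
  rewrite [leRHS]mulrCA ler_wpM2l// -expRD ler_expR.
  rewrite (_ : _ + - sigma * t = sigma * (H + h - t)); last by ring.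
  by rewrite ler_wpM2l ?(ltW sigma0)//; lra.
have hx : supnorm_closed r (history t x) <= k1 * (Dx + Du) * expR (- sigma * t).
  apply: supnorm_closed_le => // s /andP[rs s0].
  apply: (le_trans (enorm_le_mxnorm _)).
  apply: le_trans (shift n%:R r s (ler0n _ _) rs); rewrite ler_wpM2l// /history xdecay//.
  by rewrite (le_trans rs)// lerDr.
have hu : supnorm_open (r + tau) (history t u) <= k2 * (Dx + Du) * expR (- sigma * t).
  apply: supnorm_open_le => // s /andP[rs s0].
  apply: (le_trans (enorm_le_mxnorm _)).
  apply: le_trans (shift m%:R (r + tau) s (ler0n _ _) rs).
  rewrite ler_wpM2l// /history udecay//.
  by rewrite (le_trans rs)// lerDr.
apply: (le_trans (lerD hx hu)).
rewrite -!mulrDl ler_wpM2r ?expR_ge0// ler_wpM2r//.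
by rewrite lerDl.
Qed.
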